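(* Let $d\geq 1$ be an integer. Then \[ M''(2t,2,d)\geq t(d+1)-1 \quad\text{for } t\geq 1,\qquad M''(2t+1,2,d)\geq t(d+1)\quad\text{for } t\geq 0. \] Moreover, these bounds are optimal (hold with equality) for $M''(n,2,1)$, $M''(3,2,d)$ and $M''(2,2,d)$; that is, $M''(n,2,1)=n-1$, $M''(3,2,d)=d+1$ and $M''(2,2,d)=d$.
   Context: All measures are probability measures on $\mathbb{R}^d$ absolutely continuous with respect to Lebesgue measure. A partition of $\mathbb{R}^d$ into $n$ parts formed by iterated hyperplane cuts is an ordered tuple $(K_1,\dots,K_n)$ of closed convex sets (some possibly empty) obtained by starting from the single part $\mathbb{R}^d$ and repeatedly choosing one existing part $C$ and replacing it by the two parts $C\cap H^+$ and $C\cap H^-$, where $H^+,H^-$ are the two closed half-spaces of an affine hyperplane (degenerate choices $\{H^+,H^-\}=\{\emptyset,\mathbb{R}^d\}$ allowed), until there are $n$ parts. An $r$-labeling is an arbitrary map $\ell\colon[n]\to[r]$. $M''(n,r,d)$ is the largest integer $M''$ such that for any $M''$ measures $\mu_1,\dots,\mu_{M''}$ on $\mathbb{R}^d$ there is a partition $(K_1,\dots,K_n)$ of $\mathbb{R}^d$ formed by iterated hyperplane cuts and a map $\ell\colon[n]\to[r]$ with $\mu_j\big(\bigcup_{i\in\ell^{-1}(s)}K_i\big)=\tfrac1r$ for all $1\le j\le M''$ and $1\le s\le r$. *)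

(* Defs.v *)
From HB Require Import structures.
From mathcomp Require Import all_boot all_order all_algebra.
From mathcomp Require Import all_classical all_reals all_analysis.
Set Implicit Arguments. Unset Strict Implicit. Unset Printing Implicit Defensive.
Import Order.TTheory GRing.Theory Num.Theory.
Import numFieldNormedType.Exports.
Local Open Scope classical_set_scope.
Local Open Scope ring_scope.

Section Defs.
Variables (R : realType) (d : nat).

Definition Rd : measurableType _ := g_sigma_algebraType (@open 'M[R]_(1, d)).

Definition dotp (a x : 'rV[R]_d) : R := \sum_(i < d) a ord0 i * x ord0 i.

Definition box (a b : 'rV[R]_d) : set 'rV[R]_d :=
  [set x | forall i : 'I_d, a ord0 i <= x ord0 i <= b ord0 i].
Definition box_vol (a b : 'rV[R]_d) : R := \prod_(i < d) (b ord0 i - a ord0 i).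

Definition lebesgue_null (N : set 'rV[R]_d) : Prop :=
  forall eps : R, 0 < eps -> exists a b : nat -> 'rV[R]_d,
    (forall k (i : 'I_d), a k ord0 i <= b k ord0 i) /\
    N `<=` \bigcup_k box (a k) (b k) /\
    (\sum_(0 <= k <oo) (box_vol (a k) (b k))%:E <= eps%:E)%E.

Definition abs_cont (mu : probability Rd R) : Prop :=
  forall A : set Rd, measurable A -> lebesgue_null A -> mu A = 0%E.

Definition halfspace_pair (H1 H2 : set 'rV[R]_d) : Prop :=
  (exists (a : 'rV[R]_d) (c : R), a != 0 /\
     H1 = [set x | c <= dotp a x] /\ H2 = [set x | dotp a x <= c])
  \/ (H1 = set0 /\ H2 = setT) \/ (H1 = setT /\ H2 = set0).

Inductive cut_partition : seq (set 'rV[R]_d) -> Prop :=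
| cut_base : cut_partition [:: setT]
| cut_step (s : seq (set 'rV[R]_d)) (i : nat) (H1 H2 : set 'rV[R]_d) :
    cut_partition s -> (i < size s)%N -> halfspace_pair H1 H2 ->
    cut_partition (set_nth set0 s i (nth set0 s i `&` H1)
                   ++ [:: nth set0 s i `&` H2]).

Definition fair_split (n r M : nat) : Prop :=
  forall mu : 'I_M -> probability Rd R, (forall j, abs_cont (mu j)) ->
  exists K : seq (set 'rV[R]_d), cut_partition K /\ size K = n /\
  exists l : 'I_n -> 'I_r, forall (j : 'I_M) (s : 'I_r),
    mu j (\bigcup_(i in [set i : 'I_n | l i = s]) nth set0 K i)
      = ((r%:R)^-1)%:E.

(* M''(n,r,d) >= k   (M'' the supremum of the admissible M) *)
Definition Mpp_ge (n r k : nat) : Prop := exists M, (k <= M)%N /\ fair_split n r M.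

Definition Mpp_eq (n r k : nat) : Prop :=
  fair_split n r k /\ forall M, fair_split n r M -> (M <= k)%N.

End Defs.

(* Main.v *)
Require Import Defs.
From HB Require Import structures.
From mathcomp Require Import all_boot all_order all_algebra.
From mathcomp Require Import all_classical all_reals all_analysis.
From mathcomp Require Import measurable_realfun.
From mathcomp Require Import zify lra ring.
Set Implicit Arguments. Unset Strict Implicit. Unset Printing Implicit Defensive.
Import Order.TTheory GRing.Theory Num.Theory.
Import numFieldNormedType.Exports.
Local Open Scope classical_set_scope.
Local Open Scope ring_scope.

(** The lower bounds come from the Borsuk-Ulam theorem. Slice R^d into slabs by
    parallel hyperplanes and cut each slab by a hyperplane of its own. A slab
    width together with the hyperplane cutting the slab is a vector of R^(d+1)
    whose l1 norm is the width, so the configurations form the l1 sphere of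
    R^(t(d+1)) (or of R^(t(d+1)+1), when the last slab is left uncut and only
    gets a sign), and exchanging the two labels is the antipodal map.

    Borsuk-Ulam itself is obtained from Ky Fan's parity argument on iterated
    barycentric subdivisions of the cross-polytope, with mod 2 chains.

    For the upper bounds, take measures concentrated in small cubes: around the
    vertices of a simplex, which no hyperplane can bisect simultaneously; around
    these vertices and the centre of the simplex, which no convex set can contain
    by halves; and around n points of the line, for which n-1 cuts are too few. *)

(** * Mod 2 chains, barycentric subdivision and Fan's parity argument *)

(** The obstacle in the lower bounds is degeneracy: a vector of the sphere may have blocks without
    linear part, or blocks that vanish altogether, and closed parts overlap along their boundaries.
    Measuring the width of a slab by the l1 norm of its own block settles the vanishing blocks,
    since their slabs are empty. For the rest, each vector comes with a null set made of the
    hyperplanes it involves. Off this set the antipodal vector gives exactly the complementary side,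
    and the side of a point is stable under small changes of the vector; dominated convergence then
    supplies the continuity that Borsuk-Ulam requires.

    The l1 norm suits the topology as well: its unit sphere is the boundary of the cross-polytope,
    whose faces are flat, so subdivided simplices remain on the sphere without any projection. *)

Section Mod2Chains.
Variable T : Type.
Implicit Types (s : seq T) (c : seq (seq T)) (phi : seq T -> bool).

(* Chains mod 2 are lists of simplices; two chains are identified when every
   [phi] has the same parity on them. The empty simplex is a face of a point,
   so this is the augmented complex. *)
Fixpoint faces s : seq (seq T) :=
  if s is x :: s' then s' :: map (cons x) (faces s') else [::].

Definition bd c := flatten (map faces c).

Definition par c phi := \big[addb/false]_(s <- c) phi s.

Lemma par_cat c c' phi : par (c ++ c') phi = par c phi (+) par c' phi.
Proof. by rewrite /par big_cat. Qed.

Lemma par_flatten_map (U : Type) (f : U -> seq (seq T)) (l : seq U) phi :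
  par (flatten (map f l)) phi = \big[addb/false]_(x <- l) par (f x) phi.
Proof. by rewrite /par big_flatten big_map. Qed.

Lemma par_bd c phi : par (bd c) phi = par c (fun s => par (faces s) phi).
Proof. exact: par_flatten_map. Qed.

Lemma par_map f c phi : par (map f c) phi = par c (phi \o f).
Proof. by rewrite /par big_map. Qed.

Lemma par_addb c phi psi :
  par c (fun s => phi s (+) psi s) = par c phi (+) par c psi.
Proof. exact: big_split. Qed.

(** The cone formula: the boundary of a cone over [c] is [c] plus the cone over the boundary of [c].
    Augmentation keeps it valid over the empty simplex. *)
Lemma par_bd_cone x c phi :
  par (bd (map (cons x) c)) phi = par c phi (+) par (bd c) (phi \o cons x).
Proof.
rewrite par_bd par_map par_bd -par_addb /par; apply: eq_bigr => s _ /=.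
by rewrite /par big_cons big_map.
Qed.

Lemma par_bd_faces s phi : par (bd (faces s)) phi = false.
Proof.
elim: s phi => [|x s IH] phi; first by rewrite /par big_nil.
rewrite /= /bd /= par_cat -/(bd _) par_bd_cone IH addbF addbb //.
Qed.

End Mod2Chains.

Lemma faces_map (T U : Type) (f : T -> U) s :
  faces (map f s) = map (map f) (faces s).
Proof. by elim: s => //= x s ->; rewrite -!map_comp. Qed.

Section Faces.
Variable T : eqType.
Implicit Types s t : seq T.

Lemma mem_faces_subseq s t : t \in faces s -> subseq t s.
Proof.
elim: s t => [|x s IH] t //=; rewrite inE => /orP[/eqP ->|].
  exact: subseq_cons.
by case/mapP => u /IH us ->; rewrite /= eqxx.
Qed.

Lemma mem_faces_size s t : t \in faces s -> (size t).+1 = size s.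
Proof.
elim: s t => [|x s IH] t //=; rewrite inE => /orP[/eqP -> //|].
by case/mapP => u /IH us ->; rewrite /= us.
Qed.

(** For a repeated vertex [rem] deletes the first occurrence; deleting another one gives the same
    multiset, which is all that [p] sees. *)
Lemma par_faces_rem s (p : seq T -> bool) :
  (forall u v, perm_eq u v -> p u = p v) ->
  par (faces s) p = \big[addb/false]_(x <- s) p (rem x s).
Proof.
elim: s p => [|x s IH] p pP; first by rewrite /par !big_nil.
rewrite /par /= big_cons big_cons /= eqxx; congr (_ (+) _).
rewrite big_map -/(par _ (p \o cons x)) IH; last first.
  by move=> u v uv; apply: pP; rewrite /= perm_cons.
rewrite [LHS]big_seq [RHS]big_seq; apply: eq_bigr => y ys /=.
case: eqP => [->|//]; apply: pP.
by rewrite perm_sym; apply: perm_to_rem.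
Qed.

Lemma par_faces_perm s t (p : seq T -> bool) :
  (forall u v, perm_eq u v -> p u = p v) -> perm_eq s t ->
  par (faces s) p = par (faces t) p.
Proof.
move=> pP st; rewrite !par_faces_rem// (perm_big _ st) /=.
rewrite [LHS]big_seq [RHS]big_seq; apply: eq_bigr => y yt.
apply: pP; rewrite -(perm_cons y) -(permPl (perm_to_rem _)) ?(perm_mem st) //.
by rewrite -(permPr (perm_to_rem yt)).
Qed.

End Faces.

Fixpoint alt (b : bool) (l : seq bool) :=
  if l is x :: l' then (x == b) && alt (~~ b) l' else true.

(** An alternating word has alternating facets only by losing its first or its last letter, and the
    two start with opposite signs. A non-alternating word with an alternating facet has one pair of
    equal neighbours, and deleting either of them gives that facet, so it is counted twice. *)
Lemma par_faces_alt b l :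
  par (faces l) (alt b) = alt true l (+) alt false l.
Proof.
elim: l b => [|x l IH] b; first by rewrite /par big_nil.
rewrite /par /= big_cons big_map /=.
case: (eqVneq x b) => [->|xb] /=; last first.
  by rewrite big1 // addbF; case: x b xb => [] [] //=; rewrite addbF.
rewrite -/(par _ _) (IH (~~ b)); case: b => /=.
  by rewrite addbA addbb addFb addbF.
by case: (alt true l); case: (alt false l).
Qed.

(** Index first, then negative before positive. The tie-break makes the order antisymmetric, so a
    multiset of labels has a single sorted form. *)
Definition lable (p q : nat * bool) :=
  (p.1 < q.1)%N || ((p.1 == q.1) && (p.2 ==> q.2)).

Lemma lable_total : total lable.
Proof.
move=> [i a] [j b]; rewrite /lable /=; case: (ltngtP i j) => //= _.
by case: a b => [] [].
Qed.

Lemma lable_trans : transitive lable.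
Proof.
move=> [j b] [i a] [k c]; rewrite /lable /=.
case: a; case: b; case: c; rewrite /= ?andbT ?andbF ?orbF; lia.
Qed.

Lemma lable_anti : antisymmetric lable.
Proof.
move=> [i a] [j b]; rewrite /lable /= => H.
have -> : i = j by lia.
by congr pair; move: H; case: a; case: b => //=; rewrite andbF orbF; lia.
Qed.

(** * Signed labels and alternating simplices *)

Section Fan.
Variables (T : eqType) (lab : T -> nat * bool) (opp : T -> T).

(** Alternating simplices in the sense of Fan: read by increasing index, the labels have alternating
    signs, the first being [b]. *)
Definition fan b (s : seq T) := alt b (map snd (sort lable (map lab s))).

Definition nocompl (s : seq T) :=
  forall x y, x \in s -> y \in s -> (lab x).1 = (lab y).1 -> (lab x).2 = (lab y).2.

Lemma par_faces_fan b s : par (faces s) (fan b) = fan true s (+) fan false s.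
Proof.
pose p (l : seq (nat * bool)) := alt b (map snd (sort lable l)).
have -> : par (faces s) (fan b) = par (faces (map lab s)) p.
  by rewrite faces_map /par big_map; apply: eq_bigr.
rewrite (@par_faces_perm _ _ (sort lable (map lab s))); last 2 first.
- move=> u v uv; rewrite /p; congr (alt _ (map _ _)).
  by apply/perm_sortP => //; [exact: lable_total|exact: lable_trans|exact: lable_anti].
- by rewrite perm_sym perm_sort.
have sl := sort_sorted lable_total (map lab s).
rewrite /fan; move: (sort _ _) sl => l sl.
rewrite -(@par_faces_alt b) faces_map /par big_map [LHS]big_seq [RHS]big_seq.
apply: eq_bigr => t tl; rewrite /p sorted_sort //; first exact: lable_trans.
by apply: subseq_sorted (mem_faces_subseq tl) sl; exact: lable_trans.
Qed.

(** Changing signs reverses only the tie-break of [lable], and without complementary labels a tie is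
    an equality. Hence antipodal simplices are sorted alike, and [fan] exchanges its two starting
    signs. *)
Lemma sorted_map_neg (l : seq (nat * bool)) :
  {in l &, forall p q, p.1 = q.1 -> p.2 = q.2} -> sorted lable l ->
  sorted lable (map (fun p => (p.1, ~~ p.2)) l).
Proof.
case: l => [//|x l] /=; elim: l x => [//|y l IH] x H /= /andP[xy yl].
apply/andP; split; last first.
  apply: IH => // p q pl ql; apply: H; rewrite inE.
    by rewrite pl orbT.
  by rewrite ql orbT.
have := H x y; rewrite !inE !eqxx /= orbT => /(_ isT isT) {}H.
move: xy; rewrite /lable /=; case/orP => [->//|/andP[/eqP e _]].
by rewrite e eqxx (H e) implybb orbT.
Qed.

Lemma alt_neg b l : alt b (map negb l) = alt (~~ b) l.
Proof. by elim: l b => //= x l IH b; rewrite IH; case: x b => [] []. Qed.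

Lemma fan_opp b s : nocompl s ->
  (forall x, x \in s -> lab (opp x) = ((lab x).1, ~~ (lab x).2)) ->
  fan b (map opp s) = fan (~~ b) s.
Proof.
move=> nc lab_opp; pose neg (p : nat * bool) := (p.1, ~~ p.2).
rewrite /fan -alt_neg; congr alt.
have -> : sort lable (map lab (map opp s)) = map neg (sort lable (map lab s)).
  rewrite -map_comp (@eq_in_map _ _ _ (neg \o lab) _).1 //.
  apply: (sorted_eq lable_trans lable_anti).
  - exact: sort_sorted lable_total _.
  - apply: sorted_map_neg; last exact: sort_sorted lable_total _.
    by move=> p q; rewrite !mem_sort => /mapP[x xs ->] /mapP[y ys ->]; exact: nc.
  - by rewrite map_comp (perm_trans (permEl (perm_sort _ _)))// perm_map // perm_sym perm_sort.
by rewrite -!map_comp.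
Qed.

Lemma alt_sorted_ltn b (l : seq (nat * bool)) :
  {in l &, forall p q, p.1 = q.1 -> p.2 = q.2} -> sorted lable l ->
  alt b (map snd l) -> sorted ltn (map fst l).
Proof.
case: l => [//|x l] /=; elim: l x b => [//|y l IH] x b H /= /andP[xy yl].
move=> /andP[/eqP xb] /andP[/eqP yb al]; apply/andP; split; last first.
  apply: (IH y (~~ b)) => //=; last by rewrite yb eqxx.
  move=> p q pl ql; apply: H; rewrite inE.
    by rewrite pl orbT.
  by rewrite ql orbT.
have := H x y; rewrite !inE !eqxx /= orbT => /(_ isT isT) {}H.
move: xy; rewrite /lable /=; case/orP => [->//|/andP[/eqP e _]].
by have := H e; rewrite xb yb; case: (b).
Qed.

(** Without complementary labels alternation forces distinct indices, and only [N] of them are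
    available. *)
Lemma fan_false N b s : nocompl s -> (forall x, x \in s -> ((lab x).1 < N)%N) ->
  (N < size s)%N -> fan b s = false.
Proof.
move=> nc lt sz; apply/negP => alts.
have so : sorted ltn (map fst (sort lable (map lab s))).
  apply: alt_sorted_ltn (sort_sorted lable_total _) alts => p q.
  by rewrite !mem_sort => /mapP[x xs ->] /mapP[y ys ->]; exact: nc.
have un : uniq (map fst (sort lable (map lab s))).
  exact: (sorted_uniq ltn_trans ltnn).
have : (size (map fst (sort lable (map lab s))) <= size (iota 0 N))%N.
  apply: uniq_leq_size => // i /mapP[p]; rewrite mem_sort => /mapP[x xs ->] ->.
  by rewrite mem_iota /= lt.
by rewrite !size_map size_sort size_map size_iota leqNgt sz.
Qed.

End Fan.

(** * Barycentric subdivision: chain map, symmetry, mesh *)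

Section Subdivision.
Variables (R : realType) (V : normedModType R).
Implicit Types (s t : seq V) (c : seq (seq V)).

Definition bary s : V := (size s)%:R^-1 *: \sum_(x <- s) x.

Fixpoint sdn n s : seq (seq V) :=
  if n is n'.+1 then map (cons (bary s)) (flatten (map (sdn n') (faces s)))
  else [:: [::]].

Definition sd c := flatten (map (fun s => sdn (size s) s) c).

Lemma par_sd c phi : par (sd c) phi = par c (fun s => par (sdn (size s) s) phi).
Proof. exact: par_flatten_map. Qed.

(** Subdivision is a chain map. The cone formula leaves the subdivided boundary plus a cone over the
    boundary of that; by induction the latter is the subdivision of a double boundary, hence
    zero. *)
Lemma par_bd_sdn n s phi : size s = n ->
  par (bd (sdn n s)) phi = par (flatten (map (sdn n.-1) (faces s))) phi.
Proof.
elim: n s phi => [|n IH] s phi.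
  by move/size0nil => ->; rewrite /par !big_nil.
move=> sn /=; rewrite par_bd_cone.
set psi := (phi \o cons _).
suff -> : par (bd (flatten (map (sdn n) (faces s)))) psi = false by rewrite addbF.
pose chi u := par (sdn n.-1 u) psi.
rewrite -(par_bd_faces s chi) !par_bd par_flatten_map.
rewrite [RHS]/par [LHS]big_seq [RHS]big_seq; apply: eq_bigr => t ts.
rewrite -par_bd IH ?par_flatten_map //.
by have := mem_faces_size ts; rewrite sn => -[].
Qed.

Lemma par_bd_sd c phi : par (bd (sd c)) phi = par (sd (bd c)) phi.
Proof.
rewrite par_bd !par_sd par_bd [LHS]/par [RHS]/par; apply: eq_bigr => s _.
rewrite -par_bd par_bd_sdn // par_flatten_map [RHS]/par.
rewrite [LHS]big_seq [RHS]big_seq; apply: eq_bigr => t ts.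
by have <- := mem_faces_size ts.
Qed.

Lemma bary_opp s : bary (map -%R s) = - bary s.
Proof. by rewrite /bary size_map big_map sumrN scalerN. Qed.

Lemma sdn_opp n s : sdn n (map -%R s) = map (map -%R) (sdn n s).
Proof.
elim: n s => [//|n IH] s /=.
rewrite faces_map -map_comp (eq_map (g := map (map -%R) \o sdn n)) //.
rewrite map_comp -map_flatten -!map_comp; apply: eq_map => t /=.
by rewrite bary_opp.
Qed.

Lemma sd_opp c : sd (map (map -%R) c) = map (map -%R) (sd c).
Proof.
rewrite /sd map_flatten -!map_comp; congr flatten; apply: eq_map => s /=.
by rewrite size_map sdn_opp.
Qed.

(** Convexity, restricted to the averages that subdivision produces. *)
Definition bary_closed (A : V -> Prop) :=
  forall s, (0 < size s)%N -> (forall x, x \in s -> A x) -> A (bary s).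

Lemma sdn_closed A n s t x : bary_closed A -> size s = n ->
  (forall y, y \in s -> A y) -> t \in sdn n s -> x \in t -> A x.
Proof.
move=> cA; elim: n s t x => [|n IH] s t x.
  by move/size0nil => -> _; rewrite inE => /eqP ->.
move=> sn sA /= /mapP[u /flatten_mapP[v vs uv] ->].
rewrite inE => /orP[/eqP ->|xu]; first by apply: cA; rewrite ?sn.
apply: (IH v u) => //; first by have := mem_faces_size vs; rewrite sn => -[].
by move=> y yv; apply: sA; apply: (mem_subseq (mem_faces_subseq vs)).
Qed.

Lemma size_sdn n s t : size s = n -> t \in sdn n s -> size t = n.
Proof.
elim: n s t => [|n IH] s t.
  by move=> _; rewrite inE => /eqP ->.
move=> sn /= /mapP[u /flatten_mapP[v vs uv] ->] /=; congr S.
by apply: (IH v) => //; have := mem_faces_size vs; rewrite sn => -[].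
Qed.

Lemma bary_closed_ball (b : V) r : bary_closed (fun x => `|b - x| <= r).
Proof.
move=> s s0 sr.
have s0' : (size s)%:R != 0 :> R by rewrite pnatr_eq0 -lt0n.
have -> : b - bary s = (size s)%:R^-1 *: \sum_(x <- s) (b - x).
  rewrite sumrB scalerBr big_const_seq count_predT iter_addr_0 -(scaler_nat _ b).
  by rewrite scalerA mulVf // scale1r.
rewrite normrZ ger0_norm ?invr_ge0 ?ler0n //.
rewrite ler_pdivrMl ?ltr0n //.
apply: le_trans (ler_norm_sum _ _ _) _.
apply: (@le_trans _ _ (\sum_(x <- s) r)).
  by rewrite big_seq [leRHS]big_seq; apply: ler_sum => x xs; exact: sr.
by rewrite big_const_seq count_predT iter_addr_0 mulr_natl.
Qed.

(** In the average of the differences [y - x] the term [y = x] vanishes, whence the factor below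
    1. *)
Lemma bary_dist s D x : x \in s ->
  (forall y z, y \in s -> z \in s -> `|y - z| <= D) ->
  `|bary s - x| <= (1 - (size s)%:R^-1) * D.
Proof.
move=> xs sD.
have s0 : (0 < size s)%N by case: (s) xs.
have s0' : (size s)%:R != 0 :> R by rewrite pnatr_eq0 -lt0n.
have -> : bary s - x = (size s)%:R^-1 *: \sum_(y <- rem x s) (y - x).
  have -> : \sum_(y <- rem x s) (y - x) = \sum_(y <- s) (y - x).
    by rewrite [RHS](perm_big _ (perm_to_rem xs)) /= big_cons subrr add0r.
  rewrite sumrB scalerBr big_const_seq count_predT iter_addr_0 -(scaler_nat _ x).
  by rewrite scalerA mulVf // scale1r.
have -> : 1 - (size s)%:R^-1 = (size s)%:R^-1 * (size s).-1%:R :> R.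
  by rewrite -subn1 natrB // mulrBr mulVf // mulr1.
rewrite normrZ ger0_norm ?invr_ge0 ?ler0n // -mulrA ler_wpM2l ?invr_ge0 ?ler0n //.
apply: le_trans (ler_norm_sum _ _ _) _.
apply: (@le_trans _ _ (\sum_(y <- rem x s) D)).
  rewrite big_seq [leRHS]big_seq; apply: ler_sum => y ys; apply: sD => //.
  exact: mem_rem ys.
by rewrite big_const_seq count_predT iter_addr_0 size_rem // mulr_natl.
Qed.

(** Pairs involving the barycentre are controlled at the vertices of [s], then everywhere because
    balls are [bary_closed]; other pairs lie in a subdivided facet. The factor depends on [M] only,
    so it serves all facets and can be iterated. *)
Lemma sdn_diam M n s t D : 0 <= D -> size s = n -> (n <= M)%N ->
  (forall y z, y \in s -> z \in s -> `|y - z| <= D) ->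
  t \in sdn n s ->
  forall y z, y \in t -> z \in t -> `|y - z| <= (1 - M%:R^-1) * D.
Proof.
move=> D0; elim: n s t => [|n IH] s t.
  by move=> _ _ _; rewrite inE => /eqP ->.
move=> sn nM sD /= tsd; have := tsd => /mapP[u /flatten_mapP[v vs uv] tE].
have bt x : x \in t -> `|bary s - x| <= (1 - M%:R^-1) * D.
  move=> xt.
  apply: (@sdn_closed (fun x => `|bary s - x| <= (1 - M%:R^-1) * D) n.+1 s t x
           (@bary_closed_ball _ _) sn _ tsd xt).
  move=> y ys; apply: le_trans (bary_dist ys sD) _.
  rewrite ler_wpM2r // lerD2l lerN2 sn lef_pV2 ?posrE ?ltr0n //; last by lia.
  by rewrite ler_nat.
move=> y z; rewrite tE !inE => /orP[/eqP ->|yu] /orP[/eqP ->|zu].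
- by apply: bt; rewrite tE mem_head.
- by apply: bt; rewrite tE inE zu orbT.
- by rewrite distrC; apply: bt; rewrite tE inE yu orbT.
- apply: (IH v u) => //; first by have := mem_faces_size vs; rewrite sn => -[].
  + exact: ltnW.
  + by move=> a b av bv; apply: sD; apply: (mem_subseq (mem_faces_subseq vs)).
Qed.

Lemma par_iter_sd m c c' : (forall phi, par c phi = par c' phi) ->
  forall phi, par (iter m sd c) phi = par (iter m sd c') phi.
Proof. by move=> cc'; elim: m => // m IH phi; rewrite /= !par_sd IH. Qed.

Lemma par_bd_iter_sd m c phi :
  par (bd (iter m sd c)) phi = par (iter m sd (bd c)) phi.
Proof.
elim: m phi => // m IH phi; rewrite /= par_bd_sd.
by rewrite !par_sd IH.
Qed.

Lemma iter_sd_opp m c :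
  iter m sd (map (map -%R) c) = map (map -%R) (iter m sd c).
Proof. by elim: m => //= m ->; rewrite sd_opp. Qed.

Lemma iter_sd_cat m c c' : iter m sd (c ++ c') = iter m sd c ++ iter m sd c'.
Proof. by elim: m => //= m ->; rewrite /sd map_cat flatten_cat. Qed.

Lemma iter_sd_origin m c t : t \in iter m sd c -> exists2 s, s \in c &
  [/\ size t = size s,
      forall A x, bary_closed A -> (forall y, y \in s -> A y) -> x \in t -> A x &
      forall M D, 0 <= D -> (size s <= M)%N -> (0 < M)%N ->
        (forall y z, y \in s -> z \in s -> `|y - z| <= D) ->
        forall y z, y \in t -> z \in t -> `|y - z| <= (1 - M%:R^-1) ^+ m * D].
Proof.
elim: m t => [|m IH] t /=.
  by move=> tc; exists t => //; split => // [A x _|M D _ _ _ H y z yt zt];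
    [exact|rewrite expr0 mul1r; exact: H].
case/flatten_mapP => u /IH[s sc [us uA uD]] tu; exists s => //; split.
- by rewrite (size_sdn _ tu).
- move=> A x cA sA; apply: (sdn_closed cA _ _ tu) => // y.
  exact: uA.
- move=> M D D0 sM M0 sD.
  have c0 : 0 <= 1 - M%:R^-1 :> R.
    by rewrite subr_ge0 invf_le1 ?ltr0n // ler1n.
  rewrite exprS -mulrA.
  apply: (sdn_diam _ _ _ _ tu) => //.
  + by rewrite mulr_ge0 // exprn_ge0.
  + by rewrite us.
  + exact: uD.
Qed.

(** * Cross-polytopes, hemispheres and Fan's induction *)

Section Sphere.
Variable e : nat -> V.

(** The boundary of the cross-polytope on the first [k] axes, as an iterated suspension. It starts
    from the empty simplex, which is alternating and gives the odd count at the base of Fan's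
    induction. *)
Fixpoint sphere k := if k is k'.+1 then
    map (cons (e k')) (sphere k') ++ map (cons (- e k')) (sphere k')
  else [:: [::]].

Definition hemi k := map (cons (e k)) (sphere k).

Lemma par_sphere_opp k phi :
  par (map (map -%R) (sphere k)) phi = par (sphere k) phi.
Proof.
elim: k phi => [phi|k IH phi] /=; first by [].
rewrite map_cat !par_cat addbC !par_map -[X in _ = X (+) _]IH -[X in _ = _ (+) X]IH !par_map.
congr addb; apply: eq_bigr => s _ //=.
by rewrite opprK.
Qed.

Lemma par_bd_sphere k phi : par (bd (sphere k)) phi = false.
Proof.
elim: k phi => [|k IH] phi /=; first by rewrite /par big_nil.
by rewrite /bd map_cat flatten_cat par_cat -!/(bd _) !par_bd_cone !IH !addbF addbb.
Qed.

Lemma par_bd_hemi k phi : par (bd (hemi k)) phi = par (sphere k) phi.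
Proof. by rewrite par_bd_cone par_bd_sphere addbF. Qed.

(** The lower half is the cone from [- e k] over [sphere k], whereas the antipode of [hemi k] is
    that cone over the antipode of [sphere k]; the symmetry of [sphere k] identifies them. *)
Lemma par_sphereS k phi : par (sphere k.+1) phi =
  par (hemi k ++ map (map -%R) (hemi k)) phi.
Proof.
rewrite /= !par_cat; congr addb; rewrite par_map -par_sphere_opp !par_map.
exact: eq_bigr.
Qed.

Lemma mem_sphere k s : s \in sphere k -> size s = k /\
  exists eps : nat -> bool, forall x, x \in s ->
    exists2 i, (i < k)%N & x = (-1) ^+ eps i *: e i.
Proof.
elim: k s => [|k IH] s /=; first by rewrite inE => /eqP ->; split => //; exists xpredT.
rewrite mem_cat => /orP[] /mapP[t /IH[szt [eps H]] ->]; split; rewrite /= ?szt //.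
- exists [eta eps with k |-> false] => x; rewrite inE => /orP[/eqP ->|/H[i ik ->]].
    by exists k => //=; rewrite eqxx scale1r.
  by exists i; [exact: ltnW|rewrite /= ltn_eqF].
- exists [eta eps with k |-> true] => x; rewrite inE => /orP[/eqP ->|/H[i ik ->]].
    by exists k => //=; rewrite eqxx scaleN1r.
  by exists i; [exact: ltnW|rewrite /= ltn_eqF].
Qed.

Lemma hemi_sub_sphere k : {subset hemi k <= sphere k.+1}.
Proof. by move=> s sh; rewrite /= mem_cat -/(hemi k) sh. Qed.

(* Fan's parity argument: crossing from one hemisphere to the next preserves
   the parity of the number of alternating simplices. *)
Lemma par_hemi_fan (lab : V -> nat * bool) N m k :
  (forall j s, (j <= N)%N -> s \in iter m sd (hemi j) -> nocompl lab s /\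
    forall x, x \in s -> lab (- x) = ((lab x).1, ~~ (lab x).2)) ->
  (k <= N)%N ->
  par (iter m sd (hemi k)) (fun s => fan lab true s (+) fan lab false s) = true.
Proof.
move=> nc.
(* Counting positive alternating facets: those of the boundary, which is [sphere j], have the parity
   of all alternating simplices of the hemisphere. *)
have step j : par (iter m sd (hemi j)) (fun s => fan lab true s (+) fan lab false s)
    = par (iter m sd (sphere j)) (fan lab true).
  transitivity (par (bd (iter m sd (hemi j))) (fan lab true)).
    by rewrite par_bd; apply: eq_bigr => s _; rewrite par_faces_fan.
  by rewrite par_bd_iter_sd; apply: par_iter_sd => phi; exact: par_bd_hemi.
elim: k => [|k IH] kN; rewrite step.
  suff -> : iter m sd (sphere 0) = [:: [::]] by rewrite /par big_seq1.
  by elim: (m) => //= j ->.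
(* Positive simplices of the lower hemisphere are antipodal to negative ones of the upper, so the
   positive count on the sphere is the count of both signs on one hemisphere. *)
rewrite (par_iter_sd _ (par_sphereS k)) iter_sd_cat par_cat iter_sd_opp par_map.
rewrite -[RHS](IH (ltnW kN)) par_addb; congr addb.
rewrite [LHS]/par [RHS]/par [LHS]big_seq [RHS]big_seq; apply: eq_bigr => s sh.
by have [ncs labN] := nc k s (ltnW kN) sh; exact: (@fan_opp _ lab -%R true).
Qed.

End Sphere.
End Subdivision.
Arguments sd {R V} c.

(** * The Borsuk-Ulam theorem *)

Section BorsukUlam.
Variables (R : realType).

Definition l1 n (x : 'rV[R]_n) := \sum_i `|x 0 i|.

Lemma entry_le_norm n (x : 'rV[R]_n) i : `|x 0 i| <= `|x|.
Proof.
rewrite [leRHS]/Num.norm /= mx_normrE.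
by rewrite (@le_bigmax _ _ _ 0 (fun ij : 'I_1 * 'I_n => `|x ij.1 ij.2|) (0, i)).
Qed.

Lemma norm_le_entries n (x : 'rV[R]_n) r : 0 <= r ->
  (forall i, `|x 0 i| <= r) -> `|x| <= r.
Proof.
move=> r0 xr; rewrite [leLHS]/Num.norm /= mx_normrE.
by apply/bigmax_leP; split => // -[i j] _ /=; rewrite ord1.
Qed.

Lemma l1_lip n (x y : 'rV[R]_n) : `|l1 x - l1 y| <= n%:R * `|x - y|.
Proof.
rewrite /l1 -sumrB; apply: le_trans (ler_norm_sum _ _ _) _.
rewrite (_ : n%:R * _ = \sum_(i < n) `|x - y|); last first.
  by rewrite sumr_const card_ord mulr_natl.
apply: ler_sum => i _; apply: le_trans (ler_dist_dist _ _) _.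
by have := entry_le_norm (x - y) i; rewrite !mxE.
Qed.

Lemma l1_norm n (x : 'rV[R]_n) : `|x| <= l1 x.
Proof.
apply: norm_le_entries => [|i]; first exact: sumr_ge0.
by rewrite /l1 (bigD1 i) //= lerDl sumr_ge0.
Qed.

Lemma l1N n (x : 'rV[R]_n) : l1 (- x) = l1 x.
Proof. by apply: eq_bigr => i _; rewrite mxE normrN. Qed.

Lemma l1_cluster n (x_ : nat -> 'rV[R]_n) : (forall m, l1 (x_ m) = 1) ->
  exists2 z, l1 z = 1 &
    forall e m0, 0 < e -> exists2 m, (m0 <= m)%N & `|z - x_ m| < e.
Proof.
move=> x1.
pose A := [set v : 'rV[R]_n | forall i, `[-1, 1]%classic (v ord0 i)].
have cA : compact A.
  by apply: (@rV_compact R n (fun=> `[-1, 1]%classic)) => _; exact: segment_compact.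
have xA : \forall m \near \oo, A (x_ m).
  apply: nearW => m i /=; rewrite in_itv /= -ler_norml.
  by rewrite -(x1 m); apply: le_trans (entry_le_norm _ _) (l1_norm _).
have [z [_ zc]] := cA (x_ @ \oo) _ xA.
have zP e m0 : 0 < e -> exists2 m, (m0 <= m)%N & `|z - x_ m| < e.
  move=> e0; have [||y [[m /= mm0 <-] zy]] := zc (x_ @` [set m | (m0 <= m)%N]) (ball z e).
  - by exists m0 => // m /= mm; exists m.
  - exact: nbhsx_ballx.
  - by exists m => //; move: zy; rewrite -ball_normE.
exists z => //; apply/eqP; rewrite -subr_eq0 -normr_le0; apply/ler_addgt0Pl => e e0.
rewrite addr0.
have e1 : 0 < e / n.+1%:R by rewrite divr_gt0 // ltr0n.
have [m _ zm] := zP _ 0%N e1.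
rewrite -[X in l1 z - X](x1 m); apply: le_trans (l1_lip _ _) _.
apply: (@le_trans _ _ (n.+1%:R * (e / n.+1%:R))).
  by rewrite ler_pM // ?ler_nat // ltW.
by rewrite mulrC divfK // pnatr_eq0.
Qed.

Definition face_sign (eps : nat -> bool) i : R := (-1) ^+ eps i.

(** The flat face of the l1 sphere in the closed orthant with signs [eps]; its convexity keeps the
    subdivision on the sphere. *)
Definition orthant_face n (eps : nat -> bool) (x : 'rV[R]_n) :=
  (forall i : 'I_n, 0 <= face_sign eps i * x 0 i) /\ \sum_(i < n) face_sign eps i * x 0 i = 1.

Lemma bary_entry n (s : seq 'rV[R]_n) i :
  bary s 0 i = (size s)%:R^-1 * \sum_(x <- s) x 0 i.
Proof. by rewrite /bary mxE summxE. Qed.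

Lemma bary_closed_orthant n eps : bary_closed (@orthant_face n eps).
Proof.
move=> s s0 sA; split=> [i|].
  rewrite bary_entry mulrCA mulr_ge0 ?invr_ge0 // mulr_sumr big_seq sumr_ge0 //.
  by move=> x /sA[].
under eq_bigr => i _ do rewrite bary_entry mulrCA mulr_sumr.
rewrite -mulr_sumr exchange_big /= big_seq.
under eq_bigr => x xs do rewrite (sA x xs).2.
rewrite -big_seq big_const_seq count_predT iter_addr_0 mulVf //.
by rewrite pnatr_eq0 -lt0n.
Qed.

Lemma orthant_face_l1 n eps (x : 'rV[R]_n) : orthant_face eps x -> l1 x = 1.
Proof.
case=> x0 <-; apply: eq_bigr => i _.
by rewrite -[RHS]ger0_norm // normrM normrX normrN1 expr1n mul1r.
Qed.

(** Label [x] by the index and sign of the largest coordinate of [F x] in modulus. A simplex of the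
    top hemisphere has [N + 1] vertices and there are [N] indices, so it cannot alternate; Fan's
    parity therefore forces an edge with complementary labels in every subdivision. Such edges
    shrink, and at a cluster point a nonzero [F] would contradict continuity. *)
Theorem borsuk_ulam N (F : 'rV[R]_N.+1 -> 'I_N -> R) :
  (forall x i, F (- x) i = - F x i) ->
  (forall x i e, l1 x = 1 -> 0 < e -> exists2 del, 0 < del &
    forall y, l1 y = 1 -> `|x - y| < del -> `|F x i - F y i| < e) ->
  exists2 x, l1 x = 1 & forall i, F x i = 0.
Proof.
move=> Fodd Fc; apply: contrapT => noz.
have {}noz x : l1 x = 1 -> exists i, F x i != 0.
  move=> x1; apply: contrapT => H; apply: noz; exists x => // i.
  by apply/eqP; apply: contrapT => /negP Fi; apply: H; exists i.
have N0 : (0 < N)%N.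
  have [|i _] := noz (delta_mx 0 0); last exact: leq_ltn_trans (ltn_ord i).
  rewrite /l1 (bigD1 0) //= mxE eqxx big1 ?addr0 ?normr1 // => i i0.
  by rewrite mxE (negbTE i0) andbF normr0.
pose idx x : 'I_N := [arg max_(i > Ordinal N0) `|F x i|]%O.
have idxP x i : `|F x i| <= `|F x (idx x)|.
  by rewrite /idx; case: arg_maxP => // j _ /(_ i); exact.
have idxN x : idx (- x) = idx x.
  by rewrite /idx; congr (fintype.extremum _ _ _ _); apply: funext => i; rewrite Fodd normrN.
have idx0 x : l1 x = 1 -> F x (idx x) != 0.
  move=> /noz[i Fi]; apply: contraNneq Fi => F0.
  by rewrite -normr_le0 (le_trans (idxP x i)) // F0 normr0.
pose lab x := (nat_of_ord (idx x), 0 < F x (idx x)).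
pose c : R := 1 - N.+1%:R^-1.
pose e k : 'rV[R]_N.+1 := delta_mx 0 (inord k).
have hemiP m j (s : seq 'rV[R]_N.+1) : (j <= N)%N -> s \in iter m sd (hemi e j) -> [/\ size s = j.+1,
    forall x, x \in s -> l1 x = 1 &
    forall x y, x \in s -> y \in s -> `|x - y| <= c ^+ m * 2].
  move=> jN /iter_sd_origin[t /hemi_sub_sphere/mem_sphere[szt [eps tP]] [szs sA sD]].
  have tA x : x \in t -> orthant_face eps x.
    move=> /tP[i ij ->]; split=> [k|].
      rewrite !mxE eqxx /=; case: eqP => [->|_]; last by rewrite !mulr0.
      by rewrite inordK ?(leq_trans ij) // mulr1 -expr2 sqr_ge0.
    rewrite (bigD1 (inord i)) //= !mxE !eqxx /= inordK ?(leq_trans ij) // mulr1.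
    rewrite -expr2 sqrr_sign big1 ?addr0 // => k ki.
    by rewrite !mxE (negbTE ki) andbF !mulr0.
  split; first by rewrite szs szt.
  - move=> x xs; apply: orthant_face_l1 (eps) _ _.
    exact: sA (@bary_closed_orthant _ _) tA xs.
  - apply: sD => //; first by rewrite szt ltnS.
    move=> y z /tA/orthant_face_l1 y1 /tA/orthant_face_l1 z1.
    apply: le_trans (ler_normB _ _) _.
    by have := l1_norm y; have := l1_norm z; rewrite y1 z1; lra.
have pairs m : exists xy, [/\ l1 xy.1 = 1, l1 xy.2 = 1, `|xy.1 - xy.2| <= c ^+ m * 2,
    idx xy.1 = idx xy.2 & F xy.1 (idx xy.1) > 0 /\ F xy.2 (idx xy.1) < 0].
  apply: contrapT => none.
  have nc j (s : seq 'rV[R]_N.+1) : (j <= N)%N -> s \in iter m sd (hemi e j) -> nocompl lab s /\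
      forall x, x \in s -> lab (- x) = ((lab x).1, ~~ (lab x).2).
    move=> jN /(hemiP _ _ _ jN)[szs s1 sd]; split; last first.
      move=> x /s1/idx0 x0; rewrite /lab idxN Fodd oppr_gt0 /=; congr pair.
      by rewrite ltNge le_eqVlt eq_sym (negbTE x0).
    suff H x y : x \in s -> y \in s -> idx x = idx y ->
        0 < F x (idx x) -> 0 < F y (idx y).
      move=> x y xs ys /= /val_inj xy; apply/idP/idP; first exact: H.
      exact: H.
    move=> xs ys xy x0; rewrite ltNge; apply/negP => y0; apply: none.
    exists (x, y); split; rewrite /= ?s1 ?sd //; split => //.
    by rewrite xy lt_neqAle y0 idx0 // s1.
  have := par_hemi_fan nc (leqnn N).
  rewrite /par big_seq big1 // => s sh.
  have [ncs _] := nc _ _ (leqnn N) sh; have [szs _ _] := hemiP _ _ _ (leqnn N) sh.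
  by rewrite !(@fan_false _ _ N) ?szs // => x _ /=; exact: ltn_ord.
have /choice[xy xyP] := pairs.
have [z z1 zcl] : exists2 z, l1 z = 1 &
    forall e m0, 0 < e -> exists2 m, (m0 <= m)%N & `|z - (xy m).1| < e.
  by apply: l1_cluster => m; case: (xyP m).
have [k Fk] := noz _ z1.
(* Near [z] the largest coordinate exceeds [2 * r] in modulus, so on a complementary edge it takes
   two values more than [4 * r] apart, although both are within [r] of its value at [z]. *)
pose r := `|F z k| / 3.
have r0 : 0 < r by rewrite divr_gt0 // normr_gt0.
have /choice[del delP] : forall i, exists del, 0 < del /\
    forall y, l1 y = 1 -> `|z - y| < del -> `|F z i - F y i| < r.
  by move=> i; have [del d0 dP] := Fc z i r z1 r0; exists del.
pose d := \big[Order.min/1]_i del i.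
have d0 : 0 < d by apply/bigmin_gtP; split => // i _; case: (delP i).
have dP i y : l1 y = 1 -> `|z - y| < d -> `|F z i - F y i| < r.
  by move=> y1 yd; apply: (delP i).2 => //; apply: lt_le_trans yd _; exact: bigmin_le.
have c1 : `|c| < 1.
  rewrite ger0_norm; last by rewrite subr_ge0 invf_le1 ?ltr0n // ler1n.
  by rewrite ltrBlDr ltrDl invr_gt0 ltr0n.
have [m0 m0P] : exists m0, forall m, (m0 <= m)%N -> c ^+ m * 2 < d / 2.
  have d4 : 0 < d / 4 by rewrite divr_gt0.
  have /cvgrPdist_lt/(_ _ d4)[m0 _ m0P] := cvg_expr c1.
  exists m0 => m /m0P /=; rewrite sub0r normrN => H.
  have : c ^+ m < d / 4 by apply: le_lt_trans H; exact: ler_norm.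
  lra.
have [m mm0 zx] := zcl (d / 2) m0 ltac:(by rewrite divr_gt0).
have [x1 y1 xyd idxy [Fx Fy]] := xyP m.
move: (xy m).1 (xy m).2 zx x1 y1 xyd idxy Fx Fy => x y zx x1 y1 xyd idxy Fx Fy.
have zxd : `|z - x| < d by apply: lt_trans zx _; lra.
have zyd : `|z - y| < d.
  have -> : z - y = (z - x) + (x - y) by rewrite addrA subrK.
  apply: le_lt_trans (ler_normD _ _) _; have := m0P _ mm0; lra.
have big w : l1 w = 1 -> `|z - w| < d -> 2 * r < `|F w (idx w)|.
  move=> w1 wd; apply: lt_le_trans (idxP w k).
  have := dP k w w1 wd; have := ler_normB (F z k) (F z k - F w k).
  have -> : F z k - (F z k - F w k) = F w k by ring.
  have := lerB_dist (F z k) (F z k - F w k).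
  have -> : F z k - (F z k - F w k) = F w k by ring.
  have -> : `|F z k| = 3 * r by rewrite /r; field.
  lra.
have := big x x1 zxd; have := big y y1 zyd.
rewrite -idxy (gtr0_norm Fx) (ltr0_norm Fy).
have := dP (idx x) x x1 zxd; have := dP (idx x) y y1 zyd.
rewrite !ltr_norml; lra.
Qed.

End BorsukUlam.

(** * Hyperplanes are Lebesgue null *)

Section Hyperplanes.
Variable R : realType.

Lemma open_measurable_Rd d (A : set 'rV[R]_d) :
  open A -> measurable (A : set (Rd R d)).
Proof. by move=> oA; apply: sub_sigma_algebra. Qed.

Lemma closed_measurable_Rd d (A : set 'rV[R]_d) :
  closed A -> measurable (A : set (Rd R d)).
Proof.
move=> cA; rewrite -[A]setCK; apply: measurableC.
by apply: open_measurable_Rd; exact: closed_openC.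
Qed.

Lemma dotp_continuous d (a : 'rV[R]_d) : continuous (dotp a).
Proof.
apply: continuous_big => [|i _ x]; first exact: add_continuous.
apply: (@continuous_comp _ _ _ (fun y : 'rV[R]_d => y ord0 i) ( *%R (a ord0 i))).
  exact: coord_continuous.
exact: mulrl_continuous.
Qed.

Lemma grid_cell (h x : R) m : 0 <= x <= m.+1%:R * h ->
  exists u : 'I_m.+1, u%:R * h <= x <= u%:R * h + h.
Proof.
elim: m => [|m IH] /andP[x0 xm].
  by exists ord0; rewrite mul0r add0r x0 /=; rewrite mul1r in xm.
have [xm'|xm'] := leP x (m.+1%:R * h).
  have [|u uP] := IH; first by rewrite x0.
  by exists (widen_ord (leqnSn _) u).
exists ord_max; rewrite /= (ltW xm') /=.
by rewrite -natr1 mulrDl mul1r in xm.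
Qed.

(** The family is continued by the degenerate box at 0, which has volume 0 because the dimension is
    positive; in dimension 0 the empty product would give 1. *)
Lemma lebesgue_null_finite_cover d (T : finType) (N : set 'rV[R]_d.+1)
    (lo hi : T -> 'rV[R]_d.+1) (V eps : R) :
  (forall t i, lo t ord0 i <= hi t ord0 i) ->
  (forall t, box_vol (lo t) (hi t) = V) ->
  N `<=` [set x | exists t, box (lo t) (hi t) x] -> 
  #|T|%:R * V <= eps ->
  exists a b : nat -> 'rV[R]_d.+1,
    (forall k (i : 'I_d.+1), a k ord0 i <= b k ord0 i) /\
    N `<=` \bigcup_k box (a k) (b k) /\
    (\sum_(0 <= k <oo) (box_vol (a k) (b k))%:E <= eps%:E)%E.
Proof.
move=> lohi volV cov le_eps.
pose ext (f : T -> 'rV[R]_d.+1) n :=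
  if insub n is Some i then f (enum_val (i : 'I_#|T|)) else 0.
have lt_ext n i : ext lo n ord0 i <= ext hi n ord0 i.
  by rewrite /ext; case: insub => [j|//]; exact: lohi.
have volE n : box_vol (ext lo n) (ext hi n) = if (n < #|T|)%N then V else 0.
  rewrite /ext; case: insubP => [i -> _|/negbTE ->]; first exact: volV.
  by rewrite /box_vol (bigD1 ord0) //= subrr mul0r.
have vol0 n : 0 <= box_vol (ext lo n) (ext hi n).
  by apply: prodr_ge0 => i _; rewrite subr_ge0.
exists (ext lo), (ext hi); split=> //; split.
  move=> x /cov[t tx]; exists (enum_rank t) => //.
  by rewrite /ext (valK (enum_rank t)) enum_rankK.
apply: lime_le; first by apply: is_cvg_nneseries => n _ _; rewrite lee_fin.
apply: nearW => n; rewrite sumEFin lee_fin; apply: le_trans le_eps.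
have V0 : (0 < #|T|)%N -> 0 <= V by move=> T0; have := vol0 0%N; rewrite volE T0.
have -> : \sum_(0 <= i < n) box_vol (ext lo i) (ext hi i) = V *+ minn n #|T|.
  elim: n => [|n IH]; first by rewrite big_geq // min0n.
  rewrite big_nat_recr //= IH volE; case: ltnP => nT.
    have -> : minn n.+1 #|T| = n.+1 by lia.
    by rewrite mulrSr.
  have -> : minn n.+1 #|T| = #|T| by lia.
  by rewrite addr0.
have [T0|] := posnP #|T|; first by rewrite T0 minn0 mulr0n mul0r.
move=> /V0 {}V0; by rewrite -[leLHS]mulr_natl ler_wpM2r // ler_nat geq_minr.
Qed.

(** Coordinate [k] is an affine function [g] of the others, with Lipschitz constant [L] for the sup
    norm. Over each cell of a grid of step [h] it stays within [L * h] of its value at the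
    corner. *)
Lemma bounded_hyperplane_null d (a : 'rV[R]_d.+1) c k (M : R) :
  a ord0 k != 0 -> 0 < M ->
  lebesgue_null [set y | c + dotp a y = 0 /\ forall i, `|y ord0 i| <= M].
Proof.
move=> ak M0 eps e0.
pose L := \sum_(j < d) `|a ord0 (lift k j) / a ord0 k|.
have L0 : 0 <= L by apply: sumr_ge0.
(* The [(m + 1)^d] boxes have total volume [2 L (2 M)^(d+1) / (m + 1)]. *)
pose m := Num.truncn (2 * L * (2 * M) ^+ d.+1 / eps).
pose h := 2 * M / m.+1%:R.
have h0 : 0 < h by rewrite divr_gt0 ?mulr_gt0 // ltr0n.
pose T := {ffun 'I_d -> 'I_m.+1}.
pose p (u : T) j := - M + (u j)%:R * h.
pose g (u : T) := - (c + \sum_j a ord0 (lift k j) * p u j) / a ord0 k.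
pose lo u : 'rV[R]_d.+1 :=
  \row_i if unlift k i is Some j then p u j else g u - L * h.
pose hi u : 'rV[R]_d.+1 :=
  \row_i if unlift k i is Some j then p u j + h else g u + L * h.
apply: (@lebesgue_null_finite_cover _ T _ lo hi (2 * L * h * h ^+ d)).
- move=> u i; rewrite !mxE; case: unlift => [j|]; first by rewrite lerDl ltW.
  by rewrite lerD2l; apply: le_trans (_ : 0 <= _); rewrite ?oppr_le0 mulr_ge0 // ltW.
- move=> u; rewrite /box_vol (bigD1_ord k) //= !mxE unlift_none.
  rewrite (eq_bigr (fun=> h)); last by move=> j _; rewrite !mxE liftK; ring.
  by rewrite prodr_const card_ord; congr (_ * _); ring.
- move=> y [yH yM].
  have /choice[u uP] : forall j, exists u : 'I_m.+1,
      u%:R * h <= y ord0 (lift k j) + M <= u%:R * h + h.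
    move=> j; apply: grid_cell; have := yM (lift k j); rewrite ler_norml.
    have -> : m.+1%:R * h = 2 * M by rewrite /h mulrC divfK // pnatr_eq0.
    lra.
  pose v : T := [ffun j => u j]; exists v => i; rewrite !mxE.
  case: unliftP => [j ->|->].
    by have := uP j; rewrite /p ffunE; lra.
  rewrite -ler_distl -/(g v).
  have yk : y ord0 k = - (c + \sum_j a ord0 (lift k j) * y ord0 (lift k j)) / a ord0 k.
    move: yH; rewrite /dotp (bigD1_ord k) //= => yH.
    apply: (mulIf ak); rewrite divfK //; lra.
  have -> : y ord0 k - g v =
      \sum_j (a ord0 (lift k j) / a ord0 k) * (p v j - y ord0 (lift k j)).
    under eq_bigr => j _ do rewrite mulrAC mulrBr.
    rewrite -mulr_suml sumrB yk /g; ring.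
  apply: le_trans (ler_norm_sum _ _ _) _.
  rewrite /L mulr_suml; apply: ler_sum => j _; rewrite normrM ler_wpM2l //.
  by have := uP j; rewrite /p ffunE ler_norml; lra.
- rewrite card_ffun !card_ord natrX.
  have -> : m.+1%:R ^+ d * (2 * L * h * h ^+ d) = 2 * L * (2 * M) ^+ d.+1 / m.+1%:R.
    have mh : m.+1%:R * h = 2 * M by rewrite /h mulrC divfK // pnatr_eq0.
    transitivity (2 * L * h * (m.+1%:R * h) ^+ d); first by rewrite [(m.+1%:R * h) ^+ d]exprMn mulrCA.
    by rewrite mh exprS /h !mulrA mulrAC.
  rewrite ler_pdivrMr ?ltr0n // [leRHS]mulrC -ler_pdivrMr //.
  by apply: ltW; apply: truncnS_gt.
Qed.

Lemma affine_continuous d (a : 'rV[R]_d) c : continuous (fun y => c + dotp a y).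
Proof.
move=> y; apply: (@continuousD _ _ _ (cst c) (dotp a)).
  exact: cst_continuous.
exact: dotp_continuous.
Qed.

Lemma measurable_affine_gt0 d (a : 'rV[R]_d) c :
  measurable ([set y | 0 < c + dotp a y] : set (Rd R d)).
Proof.
apply: open_measurable_Rd.
apply: (@open_comp _ _ (fun y => c + dotp a y) [set x | 0 < x]).
  by move=> y _; exact: affine_continuous.
exact: open_gt.
Qed.

Lemma measurable_affine_eq0 d (a : 'rV[R]_d) c :
  measurable ([set y | c + dotp a y = 0] : set (Rd R d)).
Proof.
apply: closed_measurable_Rd.
apply: (@closed_comp _ _ (fun y => c + dotp a y) [set x | x = 0]).
  by move=> y _; exact: affine_continuous.
exact: closed_eq.
Qed.

Lemma dotp0 d (y : 'rV[R]_d) : dotp 0 y = 0.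
Proof. by rewrite /dotp big1 // => i _; rewrite mxE mul0r. Qed.

(** The case [a = 0], [c != 0], where the set is empty, is included because a block may consist of
    its constant term alone. *)
Lemma hyperplane_measure0 d (mu : probability (Rd R d) R) a c : abs_cont mu ->
  (a != 0) || (c != 0) -> mu [set y | c + dotp a y = 0] = 0%E.
Proof.
move=> ac; have [->|a0] := eqVneq a 0 => /= [c0|_].
  rewrite (_ : [set _ | _] = set0) ?measure0 // -subset0 => y /=.
  by rewrite dotp0 addr0 => /eqP; rewrite (negbTE c0).
case: d mu a c ac a0 => [|d] mu a c ac a0.
  by move: a0; rewrite (_ : a = 0) ?eqxx //; apply/rowP => -[].
have [k ak] : exists k, a ord0 k != 0.
  apply: contrapT => H; move/eqP: a0; apply; apply/rowP => k; rewrite mxE.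
  by apply/eqP; apply: contrapT => /negP ak; apply: H; exists k.
apply/negligibleP; first exact: measurable_affine_eq0.
pose F n := [set y : 'rV[R]_d.+1 | c + dotp a y = 0 /\ forall i, `|y ord0 i| <= n.+1%:R].
have mF n : measurable (F n : set (Rd R d.+1)).
  rewrite (_ : F n = [set y | c + dotp a y = 0] `&`
    \bigcap_(i in [set: 'I_d.+1]) [set y | `|y ord0 i| <= n.+1%:R]); last first.
    apply/seteqP; split => y /= [yH yn]; split => // i; first by move=> _; exact: yn.
    exact: yn.
  apply: measurableI; first exact: measurable_affine_eq0.
  apply: fin_bigcap_measurable => [|i _]; first exact: finite_finset.
  apply: closed_measurable_Rd.
  apply: (@closed_comp _ _ (fun y : 'rV[R]_d.+1 => `|y ord0 i|) [set x | x <= n.+1%:R]).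
    move=> y _; apply: continuous_comp; first exact: coord_continuous.
    exact: norm_continuous.
  exact: closed_le.
have : mu.-negligible (\bigcup_n (F n : set (Rd R d.+1))).
  apply: negligible_bigcup => n; apply/negligibleP => //.
  by apply: ac => //; exact: bounded_hyperplane_null ak _.
apply: negligibleS => y yH; exists (Num.truncn `|y|) => //; split => // i.
by apply: le_trans (entry_le_norm y i) _; apply: ltW; exact: truncnS_gt.
Qed.

End Hyperplanes.

(** * Lower bounds *)

Section MeasureLemmas.
Local Open Scope ereal_scope.
Context (disp : measure_display) (T : measurableType disp) (R : realType).
Variable mu : probability T R.

Lemma measure_eq_off_null (A B N : set T) : measurable A -> measurable B ->
  measurable N -> mu N = 0 -> (forall y, ~ N y -> A y <-> B y) -> mu A = mu B.
Proof.
move=> mA mB mN N0.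
suff H (A' B' : set T) : measurable A' -> measurable B' ->
    (forall y, ~ N y -> A' y -> B' y) -> mu A' <= mu B'.
  move=> AB; apply/eqP; rewrite eq_le; apply/andP; split; apply: H => // y Ny.
    by move/(AB y Ny).
  by move/(AB y Ny).
move=> mA' mB' AB; apply: (@le_trans _ _ (mu (B' `|` N))).
  apply: le_measure; rewrite ?inE //; first exact: measurableU.
  by move=> y A'y; have [Ny|Ny] := pselect (N y); [right|left; exact: AB].
by apply: le_trans (measureU2 mu mB' mN) _; rewrite [X in _ + X <= _]N0 adde0.
Qed.

(** Along a sequence tending to [z] the indicators are eventually constant at each point off [N],
    and dominated convergence applies. Only the exceptional set of the limit [z] matters. *)
Lemma measure_set_continuous n (A : 'rV[R]_n -> set T) (N : set T) z (e : R) :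
  (forall z', measurable (A z')) -> measurable N -> mu N = 0 ->
  (forall y, ~ N y -> \forall z' \near z, A z' y <-> A z y) -> (0 < e)%R ->
  exists2 del, (0 < del)%R & forall z', (`|z - z'| < del)%R ->
    (`|fine (mu (A z)) - fine (mu (A z'))| < e)%R.
Proof.
move=> mA mN N0 locc e0; apply: contrapT => H.
have /choice[z_ zP] : forall k : nat, exists z',
    (`|z - z'| < k.+1%:R^-1)%R /\ (e <= `|fine (mu (A z)) - fine (mu (A z'))|)%R.
  move=> k; apply: contrapT => Hk; apply: H; exists (k.+1%:R^-1)%R.
    by rewrite invr_gt0 ltr0n.
  move=> z' zz'; rewrite ltNge; apply/negP => ez'; apply: Hk.
  by exists z'.
have zz : z_ @ \oo --> z.
  apply/cvgrPdist_lt => r r0.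
  near=> k; apply: lt_trans (zP k).1 _.
  by near: k; apply: near_infty_natSinv_lt (PosNum r0).
have mI z' : measurable_fun setT (EFin \o (\1_(A z') : T -> R)).
  by apply/measurable_EFinP; exact: measurable_indic.
have [|||_ _] := @dominated_convergence _ T R mu setT measurableT
   (fun k => EFin \o \1_(A (z_ k))) (EFin \o \1_(A z)) (EFin \o cst 1%R)
   (fun k => mI (z_ k)) (mI z).
- exists N; split => // y Hy; apply: contrapT => Ny; apply: Hy => _.
  apply: cvg_near_cst.
  have Az : \forall k \near \oo, A (z_ k) y <-> A z y by exact: zz (locc y Ny).
  apply: filterS Az => k /= Ak.
  rewrite !indicE; congr ((_ _)%:R%:E); apply/idP/idP; rewrite !inE => /Ak //.
- exact: finite_measure_integrable_cst.
- apply: nearW => y k _ /=; rewrite lee_fin indicE; case: (_ \in _) => /=.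
    by rewrite normr1.
  by rewrite normr0.
rewrite (_ : (fun n0 : nat => _) = fun k => mu (A (z_ k))); last first.
  by apply: funext => k; rewrite integral_indic // setIT.
rewrite integral_indic // setIT -[X in _ --> X](@fineK _ (mu (A z))) ?fin_num_measure // => /fine_cvg.
move=> /cvgrPdist_lt/(_ _ e0)[k0 _ /(_ k0 (leqnn _))] /=.
by rewrite ltNge (zP k0).2.
Unshelve. all: by end_near. Qed.

End MeasureLemmas.

(** * Labelled cut partitions with one pending part *)

Section Cuts.
Variables (R : realType) (d : nat).
Notation V := 'rV[R]_d.
Implicit Types (K : seq (set V)) (H G : set V).

Definition cut_at K i H1 H2 :=
  set_nth set0 K i (nth set0 K i `&` H1) ++ [:: nth set0 K i `&` H2].

Lemma size_cut K i H1 H2 : (i < size K)%N -> size (cut_at K i H1 H2) = (size K).+1.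
Proof. by move=> iK; rewrite size_cat size_set_nth /= addn1; congr S; lia. Qed.

Lemma nth_cut K i H1 H2 j : (i < size K)%N -> nth set0 (cut_at K i H1 H2) j =
  if j == i then nth set0 K i `&` H1
  else if j == size K then nth set0 K i `&` H2 else nth set0 K j.
Proof.
move=> iK; rewrite nth_cat size_set_nth (_ : maxn _ _ = size K); last by lia.
rewrite nth_set_nth /=; case: ltngtP => // [Kj|->].
- rewrite gtn_eqF ?(ltn_trans iK) // (nth_default _ (ltnW Kj)).
  by case: (j - size K)%N (subn_gt0 (size K) j) => [|k _]; [lia|rewrite /= nth_nil].
- by rewrite subnn gtn_eqF.
Qed.

(** Part [i] is the one still to be cut; its label is not decided yet. *)
Definition union_but K (lab : nat -> bool) i b (y : V) :=
  exists j, [/\ (j < size K)%N, j != i, lab j = b & nth set0 K j y].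

Definition union_all K (lab : nat -> bool) b (y : V) :=
  exists j, [/\ (j < size K)%N, lab j = b & nth set0 K j y].

Lemma union_cut K lab i H1 H2 b0 : cut_partition K -> (i < size K)%N ->
  halfspace_pair H1 H2 ->
  let K' := cut_at K i H1 H2 in let lab' := [eta lab with i |-> b0] in
  [/\ cut_partition K', size K' = (size K).+1,
    nth set0 K' i = nth set0 K i `&` H1, nth set0 K' (size K) = nth set0 K i `&` H2 &
    forall b y, union_but K' lab' (size K) b y <->
      union_but K lab i b y \/ (b = b0 /\ nth set0 K i y /\ H1 y)].
Proof.
move=> cK iK HH /=; have KS := size_cut H1 H2 iK; split => //.
- exact: cut_step.
- by rewrite nth_cut // eqxx.
- by rewrite nth_cut // eqxx gtn_eqF.
move=> b y; split=> [[j []]|[[j [jK ji lj yj]]|[-> [yi yH]]]].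
- rewrite KS ltnS nth_cut // => jK jK'; rewrite (negbTE jK') /=.
  case: eqP => [_ -> [yi yH]|/eqP ji lj yj]; first by right.
  by left; exists j; split => //; rewrite ltn_neqAle jK' jK.
- exists j; rewrite KS nth_cut // (negbTE ji) (ltn_eqF jK) /=; split => //.
    exact: ltnW.
  by rewrite (negbTE ji).
- exists i; rewrite KS nth_cut // eqxx /= eqxx; split => //; first exact: ltnW.
  by rewrite ltn_eqF.
Qed.

Lemma union_close K lab i b0 : (i < size K)%N ->
  forall b y, union_all K [eta lab with i |-> b0] b y <->
    union_but K lab i b y \/ (b = b0 /\ nth set0 K i y).
Proof.
move=> iK b y; split=> [[j [jK]]|[[j [jK ji lj yj]]|[-> yi]]] /=.
- case: eqP => [-> ->|/eqP ji lj yj]; first by right.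
  by left; exists j.
- by exists j; rewrite /= (negbTE ji).
- by exists i; rewrite /= eqxx.
Qed.

(** Two cuts peel off a slab: [H1] separates it from the rest, then [G1] and [G2] halve it. Index
    [i] ends up with the half labelled true, [size K] with the rest, which is the new pending part,
    and [(size K).+1] with the half labelled false. *)
Lemma union_slab K lab i H1 H2 G1 G2 : cut_partition K -> (i < size K)%N ->
  halfspace_pair H1 H2 -> halfspace_pair G1 G2 ->
  exists K' lab' i', [/\ cut_partition K', size K' = (size K).+2, (i' < size K')%N,
    nth set0 K' i' = nth set0 K i `&` H2 &
    forall b y, union_but K' lab' i' b y <->
      union_but K lab i b y \/ (nth set0 K i y /\ H1 y /\ if b then G1 y else G2 y)].
Proof.
move=> cK iK HH GG; pose N := size K.
have [cK1 szK1 K1i K1N _] := union_cut lab true cK iK HH.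
set K1 := cut_at K i H1 H2 in cK1 szK1 K1i K1N.
have iK1 : (i < size K1)%N by rewrite szK1 ltnW.
pose K2 := cut_at K1 i G1 G2.
have szK2 : size K2 = N.+2 by rewrite size_cut // szK1.
have K2E j : nth set0 K2 j = if j == i then nth set0 K i `&` H1 `&` G1 else
    if j == N.+1 then nth set0 K i `&` H1 `&` G2 else
    if j == N then nth set0 K i `&` H2 else nth set0 K j.
  rewrite nth_cut // szK1 K1i nth_cut //; case: eqP => // _; case: eqP => // _.
pose lab' j := if j == i then true else if j == N.+1 then false else lab j.
have iN : (i == N) = false by rewrite ltn_eqF.
have iN1 : (i == N.+1) = false by rewrite ltn_eqF // ltnW.
exists K2, lab', N; split => //; first exact: cut_step.
- by rewrite szK2.
- by rewrite K2E eq_sym iN (ltn_eqF (ltnSn N)) eqxx.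
move=> b y; split=> [[j [jK jN]]|[[j [jK ji lj yj]]|[yi [yH yG]]]].
- rewrite /lab' K2E (negbTE jN); case: (eqVneq j i) => [_ <- [[]]|ji].
    by right.
  case: (eqVneq j N.+1) => [_ <- [[]]|jN1 lj yj]; first by right.
  left; exists j; split => //; move: jK jN jN1; rewrite szK2 -/N; lia.
- exists j; rewrite /lab' K2E szK2 (negbTE ji).
  have -> : (j == N.+1) = false by rewrite ltn_eqF // ltnW.
  have jN : (j == N) = false by rewrite ltn_eqF.
  by rewrite jN; split => //; rewrite /N; lia.
- case: b yG => yG.
    exists i; rewrite /lab' K2E szK2 eqxx iN; split => //; rewrite /N; lia.
  exists N.+1; rewrite /lab' K2E szK2 eqxx (gtn_eqF (ltnSn N)) eq_sym iN1.
  by split.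
Qed.

Lemma cut_partition_closed K i : cut_partition K -> closed (nth set0 K i).
Proof.
move=> cK; elim: cK i => [|s j H1 H2 _ IH js HH] i.
  by case: i => [|i]; rewrite /= ?nth_nil; [exact: closedT|exact: closed0].
rewrite -/(cut_at s j H1 H2) nth_cut //.
have [cH1 cH2] : closed H1 /\ closed H2.
  case: HH => [[a [c [_ [-> ->]]]]|[[-> ->]|[-> ->]]]; split;
    try exact: closed0; try exact: closedT.
    apply: (@closed_comp _ _ (dotp a) [set x | c <= x]); last exact: closed_ge.
    by move=> x _; exact: dotp_continuous.
  apply: (@closed_comp _ _ (dotp a) [set x | x <= c]); last exact: closed_le.
  by move=> x _; exact: dotp_continuous.
by case: eqP => _; [|case: eqP => _]; [exact: closedI|exact: closedI|exact: IH].
Qed.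

(** When [a = 0] the sign of [c] selects a degenerate pair. Points where the function vanishes are
    left undetermined, being discarded with the walls. *)
Lemma affine_halfspaces (a : V) c : exists H1 H2, halfspace_pair H1 H2 /\
  forall y, c + dotp a y != 0 ->
    (H1 y <-> 0 < c + dotp a y) /\ (H2 y <-> c + dotp a y < 0).
Proof.
have [->|a0] := eqVneq a 0.
  have [c0|c0] := ltP 0 c.
    exists setT, set0; split; first by right; right.
    by move=> y _; rewrite dotp0 addr0; split; split => //; lra.
  exists set0, setT; split; first by right; left.
  move=> y; rewrite dotp0 addr0 => c0'; split; split => //; first lra.
  by move=> _; rewrite lt_neqAle c0' c0.
exists [set y | - c <= dotp a y], [set y | dotp a y <= - c]; split.
  by left; exists a, (- c).
move=> y yn /=; split; split.
- by move=> H; rewrite lt_neqAle eq_sym yn /=; lra.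
- lra.
- by move=> H; rewrite lt_neqAle yn /=; lra.
- lra.
Qed.

End Cuts.

(** * Slab configurations coded by vectors of the l1 sphere *)

Section Slabs.
Variables (R : realType) (d n : nat).
Implicit Types (z : 'rV[R]_n) (y : 'rV[R]_d.+1).

(* Block [i] of [z] is the affine function with constant term [bcst z i] and
   linear part [bnorm z i]; coordinates beyond the length of [z] are 0. *)
Definition coord z k : R := if insub k is Some i then z 0 i else 0.

(** Cumulative width: slab [i] lies between the levels [weight z i] and [weight z i.+1]. A block has
    [d.+2] coordinates because the space has dimension [d.+1]. *)
Definition weight z i : R := \sum_(k < i * d.+2) `|coord z k|.

Definition bcst z i : R := coord z (i * d.+2).
Definition bnorm z i : 'rV[R]_d.+1 := \row_k coord z (i * d.+2 + k.+1).
Definition bfun z i y : R := bcst z i + dotp (bnorm z i) y.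

(* For [0 < s < 1], [0 < qfun s y] means [y_0 < (2 s - 1) / (s (1 - s))]; the
   bound increases from -oo to +oo, and the half-space is empty at [s = 0] and
   full at [s = 1]. *)
Definition qnorm (s : R) : 'rV[R]_d.+1 := (- (s * (1 - s))) *: delta_mx ord0 ord0.
Definition qfun (s : R) y : R := (2 * s - 1) + dotp (qnorm s) y.

Lemma qfunE s y : qfun s y = 2 * s - 1 - s * (1 - s) * y ord0 ord0.
Proof.
rewrite /qfun /dotp (bigD1 ord0) //= !mxE eqxx /= big1 ?addr0; first by ring.
by move=> i i0; rewrite !mxE (negbTE i0) andbF mulr0 mul0r.
Qed.

(** A point is judged by the affine function of the first slab, from [i] on, whose upper boundary
    lies beyond it; the last slab has no upper boundary to test. *)
Fixpoint pos_side k i z : set 'rV[R]_d.+1 :=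
  if k is k'.+1 then
    [set y | 0 < qfun (weight z i.+1) y] `&` [set y | 0 < bfun z i y] `|`
    (~` [set y | 0 < qfun (weight z i.+1) y]) `&` pos_side k' i.+1 z
  else [set y | 0 < bfun z i y].

(** The guard discards the zero affine function, whose zero set would be the whole space; so every
    wall is null. *)
Definition wall (a : 'rV[R]_d.+1) c := [set y | (a != 0) || (c != 0) /\ c + dotp a y = 0].

Definition walls z := \bigcup_i (wall (qnorm (weight z i)) (2 * weight z i - 1) `|`
                               wall (bnorm z i) (bcst z i)).

Lemma measurable_wall a c : measurable (wall a c : set (Rd R d.+1)).
Proof.
rewrite /wall; case: (_ || _) => /=.
  rewrite (_ : [set _ | _] = [set y | c + dotp a y = 0]).
    exact: measurable_affine_eq0.
  by apply/seteqP; split => y /=; [case|split].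
by rewrite (_ : [set _ | _] = set0) //; apply/seteqP; split => y //= [].
Qed.

Lemma measurable_walls z : measurable (walls z : set (Rd R d.+1)).
Proof. by apply: bigcupT_measurable => i; apply: measurableU; exact: measurable_wall. Qed.

Lemma measurable_pos_side k i z : measurable (pos_side k i z : set (Rd R d.+1)).
Proof.
elim: k i => [|k IH] i /=; first exact: measurable_affine_gt0.
apply: measurableU; apply: measurableI => //.
- exact: measurable_affine_gt0.
- exact: measurable_affine_gt0.
- by apply: measurableC; exact: measurable_affine_gt0.
Qed.

Lemma wall_measure0 (mu : probability (Rd R d.+1) R) a c :
  abs_cont mu -> mu (wall a c) = 0%E.
Proof.
move=> ac; have [nz|nz] := boolP ((a != 0) || (c != 0)).
  rewrite (_ : wall a c = [set y | c + dotp a y = 0]); last first.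
    by apply/seteqP; split => y /=; [case|split].
  exact: hyperplane_measure0.
by rewrite (_ : wall a c = set0) ?measure0 // -subset0 => y /=; rewrite /wall /= (negbTE nz) => -[].
Qed.

Lemma walls_measure0 (mu : probability (Rd R d.+1) R) z :
  abs_cont mu -> mu (walls z) = 0%E.
Proof.
move=> ac; apply/negligibleP; first exact: measurable_walls.
apply: negligible_bigcup => i; apply: negligibleU; apply/negligibleP;
  try exact: measurable_wall; exact: wall_measure0.
Qed.

Lemma coordN z k : coord (- z) k = - coord z k.
Proof. by rewrite /coord; case: insub => [i|]; rewrite ?mxE ?oppr0. Qed.

Lemma coord_default z k : (n <= k)%N -> coord z k = 0.
Proof. by move=> nk; rewrite /coord insubN // -leqNgt. Qed.

Lemma weightN z i : weight (- z) i = weight z i.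
Proof. by apply: eq_bigr => k _; rewrite coordN normrN. Qed.

Lemma weight0 z : weight z 0 = 0.
Proof. by rewrite /weight mul0n big_ord0. Qed.

Lemma weight_full z i : (n <= i * d.+2)%N -> weight z i = l1 z.
Proof.
move=> ni; rewrite /weight /l1 -(big_mkord xpredT (fun k => `|coord z k|)).
rewrite (big_cat_nat (leq0n _) ni) //= [X in _ + X]big1_seq ?addr0; last first.
  move=> k; rewrite mem_index_iota => /andP[_ /andP[nk _]].
  by rewrite coord_default // normr0.
by rewrite big_mkord; apply: eq_bigr => k _; rewrite /coord valK.
Qed.

Lemma bfunN z i y : bfun (- z) i y = - bfun z i y.
Proof.
rewrite /bfun /bcst /dotp coordN opprD -sumrN; congr (_ + _).
by apply: eq_bigr => k _; rewrite !mxE coordN mulNr.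
Qed.

Lemma weight_eq z i : bnorm z i = 0 -> bcst z i = 0 -> weight z i.+1 = weight z i.
Proof.
move=> n0 c0; rewrite /weight -!(big_mkord xpredT (fun k => `|coord z k|)).
have le : (i * d.+2 <= i.+1 * d.+2)%N by rewrite leq_mul2r leqnSn orbT.
rewrite (big_cat_nat (leq0n _) le) //= [X in _ + X]big1_seq ?addr0 // => k.
rewrite mem_index_iota => /andP[_ /andP[ik ki]].
have [/eqP e|ne] := boolP (k == i * d.+2)%N; first by rewrite e -/(bcst z i) c0 normr0.
have kd : (k - (i * d.+2).+1 < d.+1)%N by move: ki; rewrite mulSn; lia.
move/rowP: n0 => /(_ (Ordinal kd)); rewrite !mxE /=.
by rewrite (_ : i * d.+2 + _ = k)%N => [->|]; [rewrite normr0|lia].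
Qed.

(** The boundary function is never identically zero: its constant term vanishes only at weight 1/2,
    where its linear part has the entry -1/4. *)
Lemma qfun_neq0 z i y : ~ walls z y -> qfun (weight z i) y != 0.
Proof.
move=> nw; apply/negP => /eqP q0; apply: nw; exists i => //; left; split => //.
set s := weight z i.
have [s0|s0] := eqVneq (2 * s - 1) 0; last by rewrite orbT.
rewrite orbF; have -> : s = 2^-1 by lra.
apply/eqP => /rowP /(_ ord0); rewrite !mxE eqxx /= mulr1 => H.
have : - (2^-1 * (1 - 2^-1)) = 0 :> R by [].
lra.
Qed.

(* A block whose affine function vanishes identically has zero weight, so its
   slab is empty and the vanishing does not matter. *)
Lemma bfun_neq0 z i y : ~ walls z y -> qfun (weight z i) y < 0 ->
  0 < qfun (weight z i.+1) y -> bfun z i y != 0.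
Proof.
move=> nw q1 q2; apply/negP => /eqP b0.
have [/orP nz|] := boolP ((bnorm z i != 0) || (bcst z i != 0)).
  by apply: nw; exists i => //; right; split => //; apply/orP.
rewrite negb_or !negbK => /andP[/eqP n0 /eqP c0].
by move: q2; rewrite (weight_eq n0 c0) ltNge (ltW q1).
Qed.

Lemma qfun1_gt0 y : 0 < qfun 1 y.
Proof. by rewrite qfunE; lra. Qed.

Lemma qfun0_lt0 y : qfun 0 y < 0.
Proof. by rewrite qfunE; lra. Qed.

Section Sphere.
Variables (m : nat) (z : 'rV[R]_n).
Hypotheses (z1 : l1 z = 1) (nm : (n <= m.+1 * d.+2)%N).

(** The last slab ends at level [l1 z = 1], where [qfun] is the constant 1. *)
Lemma last_bfun_neq0 y : ~ walls z y -> qfun (weight z m) y < 0 -> bfun z m y != 0.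
Proof.
by move=> nw qm; apply: bfun_neq0 => //; rewrite weight_full // z1 qfun1_gt0.
Qed.

(** Antipodal vectors have the same slab boundaries and opposite affine functions. The hypothesis on
    [qfun] puts [y] beyond the lower boundary of slab [i], so that the function of the slab
    containing [y] cannot vanish there. *)
Lemma pos_sideN k i y : (k + i = m)%N -> ~ walls z y -> qfun (weight z i) y < 0 ->
  pos_side k i (- z) y <-> ~ pos_side k i z y.
Proof.
elim: k i => [|k IH] i /=; rewrite bfunN oppr_gt0.
  rewrite add0n => -> nw qm; have := last_bfun_neq0 nw qm.
  by case: ltgtP => // ? _; split.
rewrite addSnnS weightN => km nw qi.
have := qfun_neq0 i.+1 nw; case: ltgtP => // qi1 _; last first.
  have {}IH := IH i.+1 km nw qi1.
  split; first by case=> [[]//|[_ /IH H]]; case=> [[]//|[_ /H]].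
  by move=> H; right; split => //; apply/IH => H'; apply: H; right.
have := bfun_neq0 nw qi qi1; case: ltgtP => // b _; split => //.
- by move=> _; case=> [[]|[]].
- by move=> _; left.
- by case=> [[]|[]].
- by case; left.
Qed.

Lemma coord_cont k : continuous (coord^~ k).
Proof.
rewrite /coord; case: insub => [i|] w; last exact: cst_continuous.
exact: coord_continuous.
Qed.

Lemma weight_cont i : continuous (weight^~ i).
Proof.
apply: continuous_big => [|k _ w]; first exact: add_continuous.
apply: (@continuous_comp _ _ _ (coord^~ k) Num.norm); first exact: coord_cont.
exact: norm_continuous.
Qed.

Lemma bfun_cont i y : continuous (fun w => bfun w i y).
Proof.
move=> w; apply: (@continuousD _ _ _ (bcst^~ i) (fun w => dotp (bnorm w i) y)).
  exact: coord_cont.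
move: w; apply: continuous_big => [|k _ w]; first exact: add_continuous.
apply: (@continuous_comp _ _ _ (fun w => bnorm w i ord0 k) ( *%R^~ (y ord0 k))).
  rewrite (_ : (fun _ => _) = coord^~ (i * d.+2 + k.+1)); first exact: coord_cont.
  by apply: funext => ?; rewrite mxE.
exact: mulrr_continuous.
Qed.

Lemma qfun_cont i y : continuous (fun w => qfun (weight w i) y).
Proof.
rewrite (_ : (fun _ => _) = (fun s => 2 * s - 1 - s * (1 - s) * y ord0 ord0) \o weight^~ i);
  last by apply: funext => w; rewrite /= qfunE.
move=> w; apply: continuous_comp; first exact: weight_cont.
rewrite (_ : (fun _ => _) =
  horner ((2 *: 'X - 1%:P - 'X * (1%:P - 'X) * (y ord0 ord0)%:P))).
  exact: continuous_horner.
by apply: funext => s; rewrite !hornerE.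
Qed.

Lemma near_gt0 (f : 'rV[R]_n -> R) x : {for x, continuous f} -> 0 < f x ->
  \forall w \near x, 0 < f w.
Proof. by move=> fc fx; have : f @ x --> f x := fc; move/cvgr_gt; apply. Qed.

Lemma near_lt0 (f : 'rV[R]_n -> R) x : {for x, continuous f} -> f x < 0 ->
  \forall w \near x, f w < 0.
Proof. by move=> fc fx; have : f @ x --> f x := fc; move/cvgr_lt; apply. Qed.

(** Off the walls all the comparisons that decide the side of [y] are strict, hence persist near
    [z]. *)
Lemma pos_side_near k i y : (k + i = m)%N -> ~ walls z y -> qfun (weight z i) y < 0 ->
  \forall w \near z, pos_side k i w y <-> pos_side k i z y.
Proof.
elim: k i => [|k IH] i /=.
  rewrite add0n => -> nw qm; have bm := last_bfun_neq0 nw qm.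
  have [b0|b0|/eqP] := ltgtP 0 (bfun z m y); last by rewrite eq_sym (negbTE bm).
    by have := near_gt0 (@bfun_cont m y z) b0; apply: filterS => w ->.
  have := near_lt0 (@bfun_cont m y z) b0; apply: filterS => w /= w0.
  by split=> // w0'; move: (lt_trans w0 w0'); rewrite ltxx.
rewrite addSnnS => km nw qi; have qn := qfun_neq0 i.+1 nw.
have [q0|q0|/eqP] := ltgtP 0 (qfun (weight z i.+1) y); last by rewrite eq_sym (negbTE qn).
  have bn := bfun_neq0 nw qi q0.
  have := near_gt0 (@qfun_cont i.+1 y z) q0.
  have [b0|b0|/eqP] := ltgtP 0 (bfun z i y); last by rewrite eq_sym (negbTE bn).
    have := near_gt0 (@bfun_cont i y z) b0; apply: filterS2 => w /= b1 q1.
    by split=> _; left.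
  have := near_lt0 (@bfun_cont i y z) b0; apply: filterS2 => w /= b1 q1.
  by split=> -[[_ b]|[]//]; [move: (lt_trans b1 b)|]; rewrite ?ltxx.
have := IH i.+1 km nw q0.
have := near_lt0 (@qfun_cont i.+1 y z) q0; apply: filterS2 => w /= q1 IHw.
have nq : ~ (0 < qfun (weight w i.+1) y) by move=> /(lt_trans q1); rewrite ltxx.
split=> -[[]//|[_ /IHw H]]; right; split => //.
Qed.

(** Each slab before the last costs two cuts. The final pending part is the last slab, left uncut so
    that even and odd numbers of parts can finish differently. *)
Lemma slab_cuts k i (K : seq (set 'rV[R]_d.+1)) lab idx : (k + i = m)%N ->
  cut_partition K -> (idx < size K)%N ->
  exists K' lab' idx', [/\ cut_partition K', size K' = (size K + k.*2)%N,
    (idx' < size K')%N &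
    forall y, ~ walls z y -> (nth set0 K idx y -> qfun (weight z i) y < 0) ->
      (nth set0 K' idx' y -> qfun (weight z m) y < 0) /\
      forall b, union_but K' lab' idx' b y \/
          (nth set0 K' idx' y /\ if b then 0 < bfun z m y else bfun z m y < 0) <->
        union_but K lab idx b y \/
          (nth set0 K idx y /\ if b then pos_side k i z y else ~ pos_side k i z y)].
Proof.
elim: k i K lab idx => [|k IH] i K lab idx.
  rewrite add0n => -> cK iK; exists K, lab, idx; split => //.
    by rewrite addn0.
  move=> y nw qm; split => // -[//|]; split=> -[|[yK b]]; try by left.
    by right; split => //; rewrite /= => b'; move: (lt_trans b b'); rewrite ltxx.
  right; split => //; have := last_bfun_neq0 nw (qm yK).
  by move: b => /=; case: ltgtP.
rewrite addSnnS => km cK iK.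
have [H1 [H2 [HH HP]]] := affine_halfspaces (qnorm (weight z i.+1)) (2 * weight z i.+1 - 1).
have [G1 [G2 [GG GP]]] := affine_halfspaces (bnorm z i) (bcst z i).
have [K1 [lab1 [idx1 [cK1 sz1 iK1 K1E U1]]]] := union_slab lab cK iK HH GG.
have [K' [lab' [idx' [cK' sz' iK' P']]]] := IH i.+1 K1 lab1 idx1 km cK1 iK1.
exists K', lab', idx'; split => //; first by rewrite sz' sz1; lia.
move=> y nw yq; have qn := qfun_neq0 i.+1 nw.
have [H1P H2P] := HP y qn.
have [|q' U'] := P' y nw; first by rewrite K1E => -[_ /H2P].
split => // b; apply: (iff_trans (U' b)); rewrite U1 K1E.
have [yK|yK] := pselect (nth set0 K idx y); last first.
  by rewrite /setI /=; tauto.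
have {}yq := yq yK.
have h2 : H2 y <-> qfun (weight z i.+1) y < 0 by exact: H2P.
have h1 : H1 y <-> 0 < qfun (weight z i.+1) y by exact: H1P.
have [q0|q0|/eqP] := ltgtP 0 (qfun (weight z i.+1) y); last by rewrite eq_sym (negbTE qn).
  have bn := bfun_neq0 nw yq q0; have [G1P G2P] := GP y bn.
  have PE : pos_side k.+1 i z y <-> G1 y.
    rewrite /= G1P; split; first by case=> -[].
    by left.
  have NE : G2 y <-> ~ G1 y.
    rewrite G1P G2P -/(bfun z i y); move: bn.
    by case: ltgtP.
  have nh2 : ~ H2 y by rewrite h2 => /(lt_trans q0); rewrite ltxx.
  rewrite -/(pos_side k.+1 i z); move: (pos_side k.+1 i z y) PE => P PE.
  by case: b => /=; rewrite /setI /=; tauto.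
have nh1 : ~ H1 y by rewrite h1 => /(lt_trans q0); rewrite ltxx.
have PE : pos_side k.+1 i z y <-> pos_side k i.+1 z y.
  split; first by case=> -[] // /h1.
  by right; split => // /h1.
rewrite -/(pos_side k.+1 i z); move: (pos_side k.+1 i z y) PE => P PE.
by have := h2.2 q0; case: b => /=; rewrite /setI /=; tauto.
Qed.

End Sphere.
End Slabs.

Lemma fair_split_of_labelled (R : realType) d n M
    (mu : 'I_M -> probability (Rd R d) R) (K : seq (set 'rV[R]_d)) lab
    (A N : set 'rV[R]_d) :
  cut_partition K -> size K = n ->
  measurable (A : set (Rd R d)) -> measurable (N : set (Rd R d)) ->
  (forall j, mu j N = 0%E) -> (forall j, mu j A = (2^-1)%:E) ->
  (forall y, ~ N y -> forall b, union_all K lab b y <-> if b then A y else ~ A y) ->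
  exists K : seq (set 'rV[R]_d), cut_partition K /\ size K = n /\
    exists l : 'I_n -> 'I_2, forall (j : 'I_M) (s : 'I_2),
      mu j (\bigcup_(i in [set i : 'I_n | l i = s]) nth set0 K i) = (2%:R^-1)%:E.
Proof.
move=> cK szK mA mN N0 muA UA; exists K; split => //; split => //.
exists (fun i => if lab i then ord0 else ord_max) => j s.
set U := \bigcup_(_ in _) _.
have UE y : U y <-> union_all K lab (s == ord0) y.
  split=> [[i /= li yi]|[k [kK lk yk]]].
    by exists i; rewrite szK -li; split => //; case: (lab i).
  rewrite szK in kK; exists (Ordinal kK) => //=; rewrite lk.
  by case: eqP => [->//|/eqP s0]; apply/val_inj; move: s0; case: (s) => -[|[]].
have mU : measurable (U : set (Rd R d)).
  apply: fin_bigcup_measurable; first exact: finite_finset.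
  by move=> i _; apply: closed_measurable_Rd; exact: cut_partition_closed.
case: (boolP (s == ord0)) UE => _ UE.
  rewrite -(muA j); apply: (measure_eq_off_null mU mA mN) => // y Ny.
  by rewrite UE UA.
have -> : mu j U = mu j (~` A).
  apply: (measure_eq_off_null mU _ mN) => //; first exact: measurableC.
  by move=> y Ny; rewrite UE UA.
rewrite probability_setC // muA -EFinB; congr EFin; lra.
Qed.

(** [F] compares the positive sides of antipodal vectors, which are complementary off the walls, so
    a common zero means halves. Peeling off [m] slabs makes [2 m + 1] parts; the last slab is then
    either cut once more or labelled whole. *)
Lemma fair_split_lower (R : realType) d m n M :
  (M.+1 <= m.+1 * d.+2)%N ->
  n = m.*2.+2 \/ n = m.*2.+1 /\ (M.+1 <= (m * d.+2).+1)%N ->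
  fair_split R d.+1 n 2 M.
Proof.
move=> Mm nE mu ac.
pose P (z : 'rV[R]_M.+1) : set (Rd R d.+1) := pos_side m 0 z.
have mP z : measurable (P z) by exact: measurable_pos_side.
pose F z j := fine (mu j (P z)) - fine (mu j (P (- z))).
have q0 (z : 'rV[R]_M.+1) y : qfun (weight d z 0) y < 0.
  by rewrite weight0 qfun0_lt0.
have Pc z j e : l1 z = 1 -> 0 < e -> exists2 del, 0 < del & forall z',
    `|z - z'| < del -> `|fine (mu j (P z)) - fine (mu j (P z'))| < e.
  move=> z1; apply: (@measure_set_continuous _ _ _ _ _ P (walls z)) => //.
  - exact: measurable_walls.
  - exact: walls_measure0.
  - by move=> y nw; apply: pos_side_near => //; rewrite addn0.
have [z z1 Fz] : exists2 z, l1 z = 1 & forall j, F z j = 0.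
  apply: borsuk_ulam => [x j|x j e x1 e0]; first by rewrite /F opprK opprB.
  have e2 : 0 < e / 2 by rewrite divr_gt0.
  have [d1 d10 d1P] := Pc x j _ x1 e2.
  have [|d2 d20 d2P] := Pc (- x) j _ _ e2; first by rewrite l1N.
  exists (Order.min d1 d2); first by rewrite lt_min d10.
  move=> y y1; rewrite lt_min => /andP[/d1P y1P xy2].
  have := d2P (- y); rewrite opprK addrC distrC => /(_ xy2).
  move: y1P; rewrite /F !ltr_norml; lra.
have mb : measurable (walls z : set (Rd R d.+1)) by exact: measurable_walls.
have PN y : ~ walls z y -> P (- z) y <-> ~ P z y.
  by move=> nw; apply: pos_sideN => //; rewrite addn0.
have half j : mu j (P z) = (2^-1)%:E.
  have E : mu j (P (- z)) = mu j (~` P z).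
    apply: (measure_eq_off_null (mP _) _ mb) => //; first exact: measurableC.
    exact: walls_measure0.
  have /fineK fm := fin_num_measure (mu j) _ (mP z).
  have := Fz j; rewrite /F E probability_setC // -fm /= => H.
  congr EFin; lra.
have cK0 : @cut_partition R d.+1 [:: setT] by exact: cut_base.
have [K [lab [idx [cK szK iK KP]]]] :=
  slab_cuts z1 Mm xpredT (idx := 0%N) (addn0 m) cK0 isT.
have szK' : size K = m.*2.+1 by rewrite szK.
have {}KP y : ~ walls z y -> (nth set0 K idx y -> bfun z m y != 0) /\
    forall b, union_but K lab idx b y \/
      (nth set0 K idx y /\ if b then 0 < bfun z m y else bfun z m y < 0) <->
      if b then P z y else ~ P z y.
  move=> nw; have [//|qm KU] := KP y nw; split.
    by move=> /qm; apply: last_bfun_neq0.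
  move=> b; rewrite KU /=; split=> [[[[|j] [//= _ _]]|[_ //]]|H]; by right.
case: nE => [nE|[nE Mm']].
- have [G1 [G2 [GG GP]]] := affine_halfspaces (bnorm d z m) (bcst d z m).
  have [cK' szK1 _ K'N UK'] := union_cut lab true cK iK GG.
  apply: (fair_split_of_labelled (lab := [eta [eta lab with idx |-> true] with size K |-> false])
            cK' _ (mP z) mb _ half).
  + by rewrite szK1 szK' nE.
  + by move=> j; exact: walls_measure0.
  move=> y nw b; have [bn <-] := KP y nw.
  rewrite union_close ?szK1 // UK' K'N.
  have [yK|yK] := pselect (nth set0 K idx y); last first.
    by rewrite /setI /=; tauto.
  have [G1P G2P] := GP y (bn yK).
  rewrite -/(bfun z m y) in G1P G2P.
  by case: b; rewrite /setI /=; intuition.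
(* Here at most one coordinate falls into block [m], its constant term, whose sign labels the last
   slab. *)
- have bE (y : 'rV[R]_d.+1) : bfun z m y = bcst d z m.
    have b0 : bnorm d z m = 0; last by rewrite /bfun b0 dotp0 addr0.
    by apply/rowP => k; rewrite !mxE coord_default //; lia.
  apply: (fair_split_of_labelled (lab := [eta lab with idx |-> 0 < bcst d z m])
            cK _ (mP z) mb _ half).
  + by rewrite szK' nE.
  + by move=> j; exact: walls_measure0.
  move=> y nw b; have [bn <-] := KP y nw.
  rewrite union_close // bE.
  have [yK|yK] := pselect (nth set0 K idx y); last by tauto.
  have := bn yK; rewrite bE.
  by case: b; case: ltgtP => // _ _; intuition.
Qed.

(** * Uniform measures on cubes *)

Section UniformBox.
Variable R : realType.

Lemma near_center (u q r : R) : u - r < q < u + r -> q - r < u < q + r.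
Proof. lra. Qed.

Lemma near_center_dist (u x q r e : R) : r < e / 2 ->
  u - r < q < u + r -> q - r < x < q + r -> `|u - x| < e.
Proof. rewrite ltr_norml; lra. Qed.

(** The sigma-algebra of [Rd] comes from open sets; each is the countable union of the cubes with
    rational centre and radius [1 / (n + 1)] that it contains. *)
Lemma measurable_fun_Rd disp (T : measurableType disp) d (f : T -> Rd R d) :
  (forall i : 'I_d, measurable_fun setT (fun t => (f t : 'rV[R]_d) ord0 i)) ->
  measurable_fun setT f.
Proof.
move=> mf; apply: (@measurability _ _ T (Rd R d) setT f (@open 'M[R]_(1, d))) => //.
move=> _ [U oU <-]; rewrite setTI.
pose cell (qn : 'rV[rat]_d * nat) := [set x : 'rV[R]_d |
  forall i, ratr (qn.1 ord0 i) - qn.2.+1%:R^-1 < x ord0 i < ratr (qn.1 ord0 i) + qn.2.+1%:R^-1].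
pose good qn := cell qn `<=` U.
have -> : f @^-1` U = \bigcup_qn (if `[< good qn >] then f @^-1` cell qn else set0).
  apply/seteqP; split => [t /= Ut|t [qn _]]; last by case: asboolP => // g; exact: g.
  have /nbhs_ballP[e /= e0 eU] : nbhs (f t : 'rV[R]_d) U by exact: open_nbhs_nbhs.
  have [n _ ne] := near_infty_natSinv_lt (PosNum (divr_gt0 e0 (ltr0n R 2))).
  have {ne} := ne n (leqnn _); rewrite /= => ne.
  have /choice[q qP] : forall i, exists q : rat,
      (f t : 'rV[R]_d) ord0 i - n.+1%:R^-1 < ratr q < (f t : 'rV[R]_d) ord0 i + n.+1%:R^-1.
    move=> i; have n0 : 0 < n.+1%:R^-1 :> R by rewrite invr_gt0 ltr0n.
    have /rat_in_itvoo[q] : (f t : 'rV[R]_d) ord0 i - n.+1%:R^-1 < (f t : 'rV[R]_d) ord0 i + n.+1%:R^-1.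
      by rewrite ltrBlDr -addrA ltrDl addr_gt0.
    by rewrite in_itv /= => qP; exists q.
  exists (\row_i q i, n) => //; case: asboolP => [_|].
    by move=> i; rewrite /= mxE; exact: near_center (qP i).
  case=> x xc; apply: eU; split => // i j; rewrite ord1.
  by apply: near_center_dist ne (qP j) _; have := xc j; rewrite /= mxE.
apply: countable_bigcupT_measurable => [|qn]; first exact: countableP.
case: asboolP => // _.
rewrite (_ : _ @^-1` _ = \bigcap_(i in [set: 'I_d]) ((fun t => (f t : 'rV[R]_d) ord0 i) @^-1`
   `](ratr (qn.1 ord0 i) - qn.2.+1%:R^-1), (ratr (qn.1 ord0 i) + qn.2.+1%:R^-1)[%classic)).
  apply: fin_bigcap_measurable => [|i _]; first exact: finite_finset.
  by rewrite -[X in measurable X]setTI; apply: mf => //; exact: measurable_itv.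
apply/seteqP; split => [t ct i _|t ct i]; first by rewrite /= in_itv /=; exact: ct.
by have := ct i I; rewrite /= in_itv.
Qed.

Lemma measurable_entry d (i : 'I_d) :
  measurable_fun setT (fun x : Rd R d => (x : 'rV[R]_d) ord0 i).
Proof.
apply: (measurability _ (RGenOpens.measurableE R)) => //.
move=> _ [_ [a [b ->] <-]]; rewrite setTI; apply: open_measurable_Rd.
apply: (@open_comp _ _ (fun x : 'rV[R]_d => x ord0 i)); last exact: itv_open.
by move=> x _; exact: coord_continuous.
Qed.

Lemma exists_pushforward d1 d2 (T1 : measurableType d1) (T2 : measurableType d2)
    (P : probability T1 R) (f : T1 -> T2) : measurable_fun setT f ->
  exists Q : probability T2 R, forall A, Q A = P (f @^-1` A).
Proof.
move=> mf; pose X : {mfun T1 >-> T2} := HB.pack f (isMeasurableFun.Build _ _ _ _ f mf).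
by exists (distribution P X).
Qed.

Lemma uniform_prob_itv (a b : R) (ab : a < b) (x y : R) : x <= y ->
  (uniform_prob ab `[x, y]%classic <= ((b - a)^-1 * (y - x))%:E)%E.
Proof.
move=> xy; rewrite /uniform_prob.
apply: (@le_trans _ _ (\int[lebesgue_measure]_(t in `[x, y]) ((b - a)^-1)%:E)%E).
  apply: ge0_le_integral => //=.
  - by move=> t _; rewrite lee_fin uniform_pdf_ge0.
  - by apply: measurable_funTS; apply/measurable_EFinP; exact: measurable_uniform_pdf.
  - by move=> t _; rewrite lee_fin /uniform_pdf; case: ifP => // _; rewrite invr_ge0 subr_ge0 ltW.
rewrite integral_cst //= lebesgue_measure_itv /= lte_fin.
case: ltP => xy'; first by rewrite -EFinD -EFinM.
by rewrite mule0 lee_fin mulr_ge0 ?invr_ge0 ?subr_ge0 // ltW.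
Qed.

Lemma closed_box d (a b : 'rV[R]_d) : closed (box a b).
Proof.
rewrite (_ : box a b = \bigcap_(i in [set: 'I_d])
  ((fun x : 'rV[R]_d => x ord0 i) @^-1` `[a ord0 i, b ord0 i]%classic)); last first.
  apply/seteqP; split => [x bx i _|x bx i]; first by rewrite /= in_itv /=; exact: bx.
  by have := bx i I; rewrite /= in_itv.
apply: closed_bigI => i _; apply: closed_comp; last exact: interval_closed.
by move=> x _; exact: coord_continuous.
Qed.

Lemma measurable_box d (a b : 'rV[R]_d) : measurable (box a b : set (Rd R d)).
Proof. by apply: closed_measurable_Rd; exact: closed_box. Qed.

(** The uniform law on a cube, built from one-dimensional uniform laws by products and starting from
    a Dirac mass in dimension 0. The density bound is kept only on boxes, which suffices for
    absolute continuity since null sets are defined by box covers. *)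
Lemma exists_box_prob d (v : 'rV[R]_d) (eta : R) : 0 < eta ->
  exists mu : probability (Rd R d) R,
    mu (box (v - const_mx eta) (v + const_mx eta)) = 1%E /\
    forall a b : 'rV[R]_d, (forall i, a ord0 i <= b ord0 i) ->
      (mu (box a b) <= ((2 * eta)^-1 ^+ d * box_vol a b)%:E)%E.
Proof.
move=> e0; elim: d v => [|d IH] v.
  pose o : Rd R 0 := (0 : 'rV[R]_0).
  exists (\d_ o : probability (Rd R 0) R); split.
    rewrite (_ : box _ _ = setT); first exact: probability_setT.
    by apply/seteqP; split => // x _ [].
  move=> a b _; rewrite /box_vol big_ord0 expr0 mulr1.
  by apply: probability_le1; exact: measurable_box.
have vv : v ord0 ord0 - eta < v ord0 ord0 + eta by lra.
pose tl (x : 'rV[R]_d.+1) : 'rV[R]_d := \row_j x ord0 (lift ord0 j).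
have [mu [mu1 muP]] := IH (tl v).
pose P := (uniform_prob vv \x mu)%E.
pose f (tx : measurableTypeR R * Rd R d) : Rd R d.+1 :=
  (\row_i (if unlift ord0 i is Some j then (tx.2 : 'rV[R]_d) ord0 j else tx.1) : 'rV[R]_d.+1).
have mf : measurable_fun setT f.
  apply: measurable_fun_Rd => i.
  rewrite (_ : (fun _ => _) = fun tx : measurableTypeR R * Rd R d =>
    if unlift ord0 i is Some j then (tx.2 : 'rV[R]_d) ord0 j else tx.1); last first.
    by apply: funext => tx; rewrite mxE.
  case: unlift => [j|]; last exact: measurable_fst.
  apply: (@measurableT_comp _ _ _ _ _ _ (fun x : Rd R d => (x : 'rV[R]_d) ord0 j)) => //.
  exact: measurable_entry.
have [Q QP] := exists_pushforward P mf.
have boxE a b : f @^-1` box a b = `[a ord0 ord0, b ord0 ord0]%classic `*` box (tl a) (tl b).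
  apply/seteqP; split => [[t x] /= bx|[t x] /= [tab bx] i].
    split; first by have := bx ord0; rewrite in_itv /= !mxE unlift_none.
    by move=> j; have := bx (lift ord0 j); rewrite !mxE liftK.
  rewrite !mxE; case: unliftP => [j ->|->].
    by have := bx j; rewrite !mxE.
  by move: tab; rewrite in_itv.
have QE a b : Q (box a b) = (uniform_prob vv `[a ord0 ord0, b ord0 ord0]%classic *
    mu (box (tl a) (tl b)))%E.
  rewrite QP boxE; apply: (product_measure1E (uniform_prob vv) mu).
    exact: measurable_itv.
  exact: measurable_box.
exists Q; split.
  rewrite QE (_ : box _ _ = box (tl v - const_mx eta) (tl v + const_mx eta)).
    by rewrite mu1 mule1 !mxE /uniform_prob integral_uniform_pdf1.
  by congr box; apply/rowP => j; rewrite !mxE.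
move=> a b ab; rewrite QE /box_vol big_ord_recl exprS.
rewrite (_ : _ * _ = ((2 * eta)^-1 * (b ord0 ord0 - a ord0 ord0)) *
   ((2 * eta)^-1 ^+ d * box_vol (tl a) (tl b))); last first.
  rewrite mulrACA; congr (_ * (_ * _)); apply: eq_bigr => j _.
  by rewrite !mxE.
rewrite EFinM; apply: lee_pmul => //.
  rewrite (_ : 2 * eta = v ord0 ord0 + eta - (v ord0 ord0 - eta)); last by ring.
  exact: uniform_prob_itv.
by apply: muP => j; rewrite !mxE.
Qed.

Lemma abs_cont_box_bound d (mu : probability (Rd R d) R) (C : R) : 0 < C ->
  (forall a b : 'rV[R]_d, (forall i, a ord0 i <= b ord0 i) ->
      (mu (box a b) <= (C * box_vol a b)%:E)%E) ->
  abs_cont mu.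
Proof.
move=> C0 muC A mA A0; apply/eqP; rewrite eq_le measure_ge0 andbT.
apply/lee_addgt0Pr => e e0; rewrite add0e.
have [a [b [ab [Aab vol]]]] := A0 (e / C) (divr_gt0 e0 C0).
have mB k : measurable (box (a k) (b k) : set (Rd R d)) by exact: measurable_box.
have := @measure_sigma_subadditive _ _ _ mu A (fun k => box (a k) (b k)) mB mA Aab.
move=> /le_trans; apply.
apply: (@le_trans _ _ (\sum_(0 <= k <oo) (C%:E * (box_vol (a k) (b k))%:E))%E).
  by apply: lee_nneseries => // k _; rewrite -EFinM; exact: muC.
rewrite nneseriesZl; last by move=> k _; rewrite lee_fin prodr_ge0 // => i _; rewrite subr_ge0.
apply: (@le_trans _ _ (C%:E * (e / C)%:E)%E).
  by rewrite lee_pmul2l.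
by rewrite -EFinM lee_fin mulrC divfK // gt_eqF.
Qed.

Lemma exists_abs_cont_box d (v : 'rV[R]_d) (eta : R) : 0 < eta ->
  exists mu : probability (Rd R d) R, abs_cont mu /\
    mu (box (v - const_mx eta) (v + const_mx eta)) = 1%E.
Proof.
move=> e0; have [mu [mu1 muC]] := exists_box_prob v e0; exists mu; split => //.
apply: (@abs_cont_box_bound _ _ ((2 * eta)^-1 ^+ d)) => //.
by rewrite exprn_gt0 // invr_gt0 mulr_gt0.
Qed.

End UniformBox.

(** * Upper bounds *)

Section Concentrated.
Variables (R : realType) (d : nat).
Implicit Types (mu : probability (Rd R d) R) (A B : set 'rV[R]_d).

Lemma full_measure_sup mu A B : measurable (A : set (Rd R d)) ->
  measurable (B : set (Rd R d)) -> mu B = 1%E -> B `<=` A -> mu A = 1%E.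
Proof.
move=> mA mB B1 BA; apply/eqP; rewrite eq_le probability_le1 //=.
by rewrite -B1 le_measure // inE.
Qed.

Lemma half_neq1 : ((2%:R^-1)%:E = 1%E :> \bar R) -> False.
Proof. by case; lra. Qed.

Lemma half_neq0 : ((2%:R^-1)%:E = 0%E :> \bar R) -> False.
Proof. by case; lra. Qed.

Lemma half_misses mu A B : measurable (A : set (Rd R d)) ->
  measurable (B : set (Rd R d)) -> mu B = 1%E -> mu A = (2%:R^-1)%:E ->
  exists2 x, B x & ~ A x.
Proof.
move=> mA mB B1 A2; apply: contrapT => H; apply: half_neq1; rewrite -A2.
apply: (full_measure_sup mA mB B1) => x Bx; apply: contrapT => Ax; apply: H.
by exists x.
Qed.

Lemma half_meets mu A B : measurable (A : set (Rd R d)) ->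
  measurable (B : set (Rd R d)) -> mu B = 1%E -> mu A = (2%:R^-1)%:E ->
  exists2 x, B x & A x.
Proof.
move=> mA mB B1 A2.
have [|x Bx nAx] := half_misses (measurableC mA) mB B1.
  rewrite probability_setC // A2 -EFinB; congr EFin; lra.
by exists x => //; apply: contrapT.
Qed.

Lemma measurable_part (K : seq (set 'rV[R]_d)) i : cut_partition K ->
  measurable (nth set0 K i : set (Rd R d)).
Proof. by move=> cK; apply: closed_measurable_Rd; exact: cut_partition_closed. Qed.

(** If [i] itself had the other label, no part would carry [s], and the measure 0 is not a half. *)
Lemma single_label_part mu (K : seq (set 'rV[R]_d)) n (l : 'I_n -> 'I_2) s i :
  (forall i', l i' = s -> i' = i) ->
  mu (\bigcup_(i' in [set i' : 'I_n | l i' = s]) nth set0 K i') = (2%:R^-1)%:E ->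
  mu (nth set0 K i) = (2%:R^-1)%:E.
Proof.
move=> uni; have [li|li] := eqVneq (l i) s.
  rewrite (_ : [set _ | _] = [set i]) ?bigcup_set1 //.
  by apply/seteqP; split => [i' /uni //|i' ->].
rewrite (_ : [set _ | _] = set0) ?bigcup_set0 ?measure0; last first.
  by rewrite -subset0 => i' /= l'; move: li; rewrite -(uni _ l') l' eqxx.
by move/esym/half_neq0.
Qed.

End Concentrated.

(** * A simplex around the origin and separating functionals *)

Section Simplex.
Variables (R : realType) (d : nat).

(* The vertices -(1,..,1), e_0, .., e_(d-1) of a simplex around the origin,
   followed by the origin itself from index d+1 on. *)
Definition center (j : nat) : 'rV[R]_d :=
  if j == 0%N then const_mx (-1) else \row_k (j == k.+1)%:R.

Lemma dotp_bound (a x : 'rV[R]_d) r : (forall k, `|x ord0 k| <= r) ->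
  `|dotp a x| <= d%:R * (`|a| * r).
Proof.
move=> xr; apply: le_trans (ler_norm_sum _ _ _) _.
rewrite (_ : d%:R * _ = \sum_(i < d) `|a| * r); last by rewrite sumr_const card_ord mulr_natl.
by apply: ler_sum => i _; rewrite normrM ler_pM // entry_le_norm.
Qed.

Lemma dotpB (a x y : 'rV[R]_d) : dotp a (x - y) = dotp a x - dotp a y.
Proof. by rewrite /dotp -sumrB; apply: eq_bigr => i _; rewrite !mxE mulrBr. Qed.

Lemma dotpNl (a x : 'rV[R]_d) : dotp (- a) x = - dotp a x.
Proof. by rewrite /dotp -sumrN; apply: eq_bigr => i _; rewrite !mxE mulNr. Qed.

Lemma dotp_center0 (a : 'rV[R]_d) : dotp a (center 0) = - \sum_k a ord0 k.
Proof. by rewrite /dotp -sumrN; apply: eq_bigr => i _; rewrite !mxE mulrN1. Qed.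

Lemma dotp_centerS (a : 'rV[R]_d) (k : 'I_d) : dotp a (center k.+1) = a ord0 k.
Proof.
rewrite /dotp (bigD1 k) //= !mxE eqxx mulr1 big1 ?addr0 // => i ik.
by rewrite !mxE eqSS val_eqE eq_sym (negbTE ik) mulr0.
Qed.

(** With [t = d r |a|], the vertices [e_k] give entries at least [- t] and the vertex [-(1,..,1)]
    gives an entry sum at most [t]. Hence [|a| <= d t = d^2 r |a|], which forces [a = 0]. *)
Lemma simplex_surrounds (a : 'rV[R]_d) (y : nat -> 'rV[R]_d) r :
  d%:R * d%:R * r < 1 -> 0 <= r ->
  (forall j k, (j <= d)%N -> `|y j ord0 k - center j ord0 k| <= r) ->
  (forall j, (j <= d)%N -> 0 <= dotp a (y j)) -> a = 0.
Proof.
move=> dr r0 yc ya.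
pose A := `|a|; have A0 : 0 <= A by exact: normr_ge0.
pose t := d%:R * (A * r).
have t0 : 0 <= t by rewrite !mulr_ge0.
have ca j : (j <= d)%N -> - t <= dotp a (center j).
  move=> jd; have := ya j jd; have := @dotp_bound a (y j - center j) r.
  have yr k : `|(y j - center j) ord0 k| <= r by rewrite !mxE; exact: yc.
  move=> /(_ yr); rewrite dotpB ler_norml -/t; lra.
have lo k : - t <= a ord0 k by rewrite -dotp_centerS ca.
have sumt : \sum_k a ord0 k <= t by have := ca 0%N isT; rewrite dotp_center0; lra.
have hi k : a ord0 k <= d%:R * t.
  have : \sum_(j < d | j != k) - t <= \sum_(j < d | j != k) a ord0 j by apply: ler_sum.
  rewrite sumr_const; move: sumt; rewrite (bigD1 k) //= => sumt.
  have -> : #|[pred j : 'I_d | j != k]| = d.-1.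
    by have := cardC1 k; rewrite card_ord => <-; apply: eq_card => j; rewrite !inE.
  have d0 : (0 < d)%N by exact: leq_ltn_trans (ltn_ord k).
  have -> : d%:R = d.-1%:R + 1 :> R by rewrite natr1 prednK.
  rewrite mulNrn -mulr_natl; move: sumt; rewrite mulrDl mul1r; lra.
have aA : `|a| <= d%:R * t.
  apply: norm_le_entries => [|k]; first by rewrite mulr_ge0.
  rewrite ler_norml hi andbT; apply: le_trans (lo k); rewrite lerN2.
  rewrite -{1}[t]mul1r ler_wpM2r // ler1n.
  exact: leq_ltn_trans (ltn_ord k).
apply/eqP; rewrite -normr_le0 -/A.
have : A <= d%:R * d%:R * r * A by move: aA; rewrite -/A /t !mulrA mulrAC.
move=> H; rewrite leNgt; apply/negP => Ap.
have : A * (d%:R * d%:R * r) < A by rewrite gtr_pMr.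
by rewrite mulrC ltNge H.
Qed.

(** A part is an intersection of half-spaces, and one of them misses [p]. An empty half-space is
    separated by the zero functional, so [a] may be 0. *)
Lemma cut_partition_separable (K : seq (set 'rV[R]_d)) i p : cut_partition K ->
  ~ nth set0 K i p -> exists a c, dotp a p < c /\ forall x, nth set0 K i x -> c <= dotp a x.
Proof.
have sep0 : exists a c, dotp a p < c /\ forall x, set0 x -> c <= dotp a x.
  by exists 0, 1; rewrite dotp0.
move=> cK; elim: cK i => [|s j H1 H2 _ IH js HH] i.
  by case: i => [|i] /= np; [exfalso; exact: np|rewrite nth_nil].
have [sep1 sep2] : (~ H1 p -> exists a c, dotp a p < c /\ forall x, H1 x -> c <= dotp a x) /\
    (~ H2 p -> exists a c, dotp a p < c /\ forall x, H2 x -> c <= dotp a x).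
  case: HH => [[a [c [_ [-> ->]]]]|[[-> ->]|[-> ->]]]; split=> np; try exact: sep0;
    try by case: np.
    by exists a, c; split => //; rewrite ltNge; exact/negP.
  exists (- a), (- c); rewrite dotpNl ltrN2 ltNge; split; first exact/negP.
  by move=> x /=; rewrite dotpNl lerN2.
have sepI A B : (~ A p -> exists a c, dotp a p < c /\ forall x, A x -> c <= dotp a x) ->
    (~ B p -> exists a c, dotp a p < c /\ forall x, B x -> c <= dotp a x) ->
    ~ (A `&` B) p -> exists a c, dotp a p < c /\ forall x, (A `&` B) x -> c <= dotp a x.
  move=> sA sB nAB; have [Ap|/sA] := pselect (A p).
    have [a [c [pc Bc]]] : exists a c, dotp a p < c /\ forall x, B x -> c <= dotp a x.
      by apply: sB => Bp; apply: nAB.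
    by exists a, c; split => // x [_ /Bc].
  by case=> a [c [pc Ac]]; exists a, c; split => // x [/Ac].
rewrite -/(cut_at s j H1 H2) nth_cut //; case: eqP => _; first exact: sepI (IH j) sep1.
case: eqP => _; first exact: sepI (IH j) sep2.
exact: IH.
Qed.

End Simplex.

Section UpperBounds.
Variable R : realType.

Definition cube d (c : 'rV[R]_d) eta := box (c - const_mx eta) (c + const_mx eta).

Lemma cubeP d (c x : 'rV[R]_d) eta : cube c eta x ->
  forall k, `|x ord0 k - c ord0 k| <= eta.
Proof. by move=> cx k; have := cx k; rewrite !mxE ler_norml; lra. Qed.

Lemma exists_concentrated d M (c : nat -> 'rV[R]_d) eta : 0 < eta ->
  exists mu : 'I_M -> probability (Rd R d) R,
    forall j : 'I_M, abs_cont (mu j) /\ mu j (cube (c j) eta) = 1%E.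
Proof.
move=> e0; have /choice[mu muP] : forall j : 'I_M, exists mu : probability (Rd R d) R,
    abs_cont mu /\ mu (cube (c j) eta) = 1%E.
  by move=> j; exact: exists_abs_cont_box.
by exists mu.
Qed.

(** Twice [eta], because with three parts both the points near the vertices and the point near the
    centre are displaced. *)
Lemma simplex_eta d : (0 < d)%N -> exists2 eta : R, 0 < eta & d%:R * d%:R * (eta + eta) < 1.
Proof.
move=> d0; exists ((4 * (d%:R * d%:R))^-1).
  by rewrite invr_gt0 !mulr_gt0 // ltr0n.
have dn : d%:R != 0 :> R by rewrite pnatr_eq0 -lt0n.
rewrite (_ : d%:R * d%:R * _ = 2^-1); first lra.
by field.
Qed.

Lemma upper3 d M : (0 < d)%N -> fair_split R d 3 2 M -> (M <= d + 1)%N.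
Proof.
move=> d0 fM; rewrite leqNgt; apply/negP => dM.
have [eta e0 eta1] := simplex_eta d0.
have [mu muP] := @exists_concentrated d M (center R d) eta e0.
have [K [cK [szK [l lP]]]] := fM mu (fun j => (muP j).1).
(* Two labels on three parts: some label occurs at most once, so a single convex part must halve all
   the measures. *)
have [s [i uni]] : exists s i, forall i', l i' = s -> i' = i.
  pose i0 : 'I_3 := ord0; pose i1 : 'I_3 := inord 1; pose i2 : 'I_3 := inord 2.
  have all3 (i : 'I_3) : [\/ i = i0, i = i1 | i = i2].
    case: i => -[|[|[|//]]] lt.
    - by apply: Or31; exact: val_inj.
    - by apply: Or32; apply: val_inj; rewrite /= inordK.
    - by apply: Or33; apply: val_inj; rewrite /= inordK.
  have [e01|n01] := eqVneq (l i0) (l i1).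
    exists (if l i0 == ord0 then ord_max else ord0), i2 => i'.
    by case: (all3 i') => -> //; rewrite -?e01; case: (eqVneq (l i0) ord0) => [->|/eqP H] // /H.
  have [e20|n20] := eqVneq (l i2) (l i0).
    exists (l i1), i1 => i'; case: (all3 i') => -> //; first by move/eqP; rewrite (negbTE n01).
    by rewrite e20 => /eqP; rewrite (negbTE n01).
  exists (l i0), i0 => i'; case: (all3 i') => -> //.
    by move/esym/eqP; rewrite (negbTE n01).
  by move/eqP; rewrite (negbTE n20).
have half (j : nat) (jM : (j < M)%N) : mu (Ordinal jM) (nth set0 K i) = (2%:R^-1)%:E.
  by apply: single_label_part uni _; exact: lP.
have mK := measurable_part i cK.
have [p pc np] : exists2 p, cube (center R d d.+1) eta p & ~ nth set0 K i p.
  have jM : (d.+1 < M)%N by rewrite -addn1.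
  apply: (half_misses mK _ (muP (Ordinal jM)).2 (half _ jM)).
  exact: measurable_box.
have [a [c [pa Ka]]] := cut_partition_separable cK np.
have /choice[x xP] : forall j : nat, exists x, (j <= d)%N -> cube (center R d j) eta x /\ nth set0 K i x.
  move=> j; have [jd|] := leqP j d; last by exists 0.
  have jM : (j < M)%N by apply: leq_ltn_trans jd (ltn_trans _ dM); rewrite addn1.
  have [x xc xK] := half_meets mK (measurable_box _ _) (muP (Ordinal jM)).2 (half _ jM).
  by exists x.
have a0 : a = 0.
  apply: (simplex_surrounds eta1 _ (y := fun j => x j - p)).
  - by rewrite addr_ge0 // ltW.
  - move=> j k jd; have /cubeP/(_ k) := (xP j jd).1; have /cubeP/(_ k) := pc.
    have -> : center R d d.+1 ord0 k = 0.
      by rewrite mxE eqSS gtn_eqF.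
    by rewrite !mxE !ler_norml; lra.
  - by move=> j jd; rewrite dotpB subr_ge0 ltW // (lt_le_trans pa) // Ka //; case: (xP j jd).
(* The zero functional separates [p] only from an empty part, but this part meets the cubes. *)
have := Ka _ (xP 0%N isT).2; move: pa; rewrite a0 !dotp0; lra.
Qed.

Lemma cut_partition_size_gt0 d (K : seq (set 'rV[R]_d)) : cut_partition K -> (0 < size K)%N.
Proof. by case=> // s i H1 H2 _ _ _; rewrite size_cat addn1. Qed.

Lemma cut_partition_size2 d (K : seq (set 'rV[R]_d)) : cut_partition K -> size K = 2%N ->
  exists H1 H2, halfspace_pair H1 H2 /\ K = [:: H1; H2].
Proof.
case=> // s i H1 H2 cs is_ HH; rewrite -/(cut_at s i H1 H2) size_cut // => -[s1].
exists H1, H2; split => //.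
have -> : i = 0%N by lia.
case: cs s1 {is_} => [_|s' i' G1 G2 cs' is' _]; first by rewrite /cut_at /= !setTI.
by rewrite -/(cut_at s' i' G1 G2) size_cut // => -[s0]; have := cut_partition_size_gt0 cs'; rewrite s0.
Qed.

Lemma upper2 d M : (0 < d)%N -> fair_split R d 2 2 M -> (M <= d)%N.
Proof.
move=> d0 fM; rewrite leqNgt; apply/negP => dM.
have [eta e0 eta1] := simplex_eta d0.
have [mu muP] := @exists_concentrated d M (center R d) eta e0.
have [K [cK [szK [l lP]]]] := fM mu (fun j => (muP j).1).
have M0 : (0 < M)%N by exact: leq_ltn_trans dM.
have n01 : l ord0 != l ord_max.
  apply/eqP => e01; pose s : 'I_2 := if l ord0 == ord0 then ord_max else ord0.
  have := lP (Ordinal M0) s; rewrite (_ : [set _ | _] = set0) ?bigcup_set0 ?measure0.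
    by move/esym/half_neq0.
  rewrite -subset0 => i /=; have -> : l i = l ord0.
    by case: i => -[|[|]] // lt; [|rewrite e01]; congr (l _); exact: val_inj.
  by rewrite /s; case: (eqVneq (l ord0) ord0) => [->|/eqP H] // /H.
have half (i : 'I_2) (j : nat) (jM : (j < M)%N) : mu (Ordinal jM) (nth set0 K i) = (2%:R^-1)%:E.
  apply: (@single_label_part _ _ _ _ _ l (l i)) (lP _ _) => i' li'.
  apply/eqP; apply: contraT => ii'; case/negP: n01; apply/eqP.
  have [e|e] : i = ord0 /\ i' = ord_max \/ i = ord_max /\ i' = ord0.
    move: ii' {li'}; case: i => -[|[|]] // lt; case: i' => -[|[|]] // lt' _; [left|right];
      by split; exact: val_inj.
  - by case: e li' => -> -> ->.
  - by case: e li' => -> -> ->.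
have meets (i : 'I_2) j : exists x : 'rV[R]_d, (j <= d)%N ->
    (forall k, `|x ord0 k - center R d j ord0 k| <= eta + eta) /\ nth set0 K i x.
  have [jd|] := leqP j d; last by exists 0.
  have jM : (j < M)%N by exact: leq_ltn_trans jd dM.
  have [x xc xK] := half_meets (measurable_part i cK) (measurable_box _ _) (muP (Ordinal jM)).2 (half i _ jM).
  exists x => _; split => // k; apply: le_trans (cubeP xc k) _.
  by rewrite lerDl ltW.
have /choice[x xP] := meets ord0; have /choice[y yP] := meets ord_max.
have [H1 [H2 [HH KE]]] := cut_partition_size2 cK szK.
have ee : 0 <= eta + eta by rewrite addr_ge0 // ltW.
rewrite {}KE /= in xP yP.
case: HH xP yP => [[a [c [a0 [-> ->]]]]|[[-> _] xP _|[_ ->] _ yP]].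
(* According to the sign of [c], [a] is nonnegative on the first half-space or [- a] on the second,
   and both half-spaces meet all the cubes. *)
- move=> /= xP yP; have [c0|c0] := leP 0 c.
    case/eqP: a0; apply: (simplex_surrounds eta1 ee (y := x)).
      by move=> j k /xP[].
    by move=> j /xP[_]; exact: le_trans.
  case/eqP: a0; apply/eqP; rewrite -oppr_eq0; apply/eqP.
  apply: (simplex_surrounds eta1 ee (y := y)) => [j k /yP[]//|j /yP[_ yc]].
  by rewrite dotpNl oppr_ge0 (le_trans yc) // ltW.
- by case: (xP 0%N isT).
- by case: (yP 0%N isT).
Qed.

(** A cut of the line is one point, and an interval avoiding all of them stays in one part. A
    degenerate cut contributes the dummy point 0, which keeps the count exact. *)
Lemma cut_points (K : seq (set 'rV[R]_1)) : cut_partition K ->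
  exists2 P : seq R, (size P).+1 = size K &
    forall u v, (forall p, p \in P -> ~~ (u <= p <= v)) ->
      exists2 i, (i < size K)%N & forall x : 'rV[R]_1, u <= x ord0 ord0 <= v -> nth set0 K i x.
Proof.
elim=> [|s i H1 H2 cs [P szP PP] is_ HH]; first by exists [::] => // u v _; exists 0%N.
rewrite -/(cut_at s i H1 H2).
have [q qP] : exists q : R, forall u v, ~~ (u <= q <= v) ->
    (forall x : 'rV[R]_1, u <= x ord0 ord0 <= v -> H1 x) \/
    (forall x : 'rV[R]_1, u <= x ord0 ord0 <= v -> H2 x).
  case: HH => [[a [c [a0 [-> ->]]]]|[[_ ->]|[-> _]]]; [|by exists 0; right|by exists 0; left].
  have a0' : a ord0 ord0 != 0.
    by apply: contra_neq a0 => a0; apply/rowP => k; rewrite ord1 a0 mxE.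
  exists (c / a ord0 ord0) => u v quv.
  have dE (x : 'rV[R]_1) : dotp a x = a ord0 ord0 * x ord0 ord0 by rewrite /dotp big_ord1.
  have cE : c = a ord0 ord0 * (c / a ord0 ord0) by rewrite mulrC divfK.
  set q := c / a ord0 ord0 in quv cE.
  have side (x : 'rV[R]_1) : u <= x ord0 ord0 <= v ->
      (u <= q -> x ord0 ord0 <= q) /\ (~~ (u <= q) -> q <= x ord0 ord0).
    move=> /andP[ux xv]; split=> uq.
      by move: quv; rewrite uq /= -ltNge => vq; rewrite (le_trans xv) // ltW.
    by rewrite ltW // (lt_le_trans _ ux) // ltNge.
  have [ap|an|/eqP] := ltgtP 0 (a ord0 ord0); last by rewrite eq_sym (negbTE a0').
    have [uq|uq] := boolP (u <= q); [right|left] => x /side[s1 s2] /=; rewrite dE cE ler_pM2l //.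
      exact: s1.
    exact: s2.
  have [uq|uq] := boolP (u <= q); [left|right] => x /side[s1 s2] /=; rewrite dE cE ler_nM2l //.
    exact: s1.
  exact: s2.
exists (q :: P); first by rewrite size_cut //= szP.
move=> u v avoid; have [p pP|j js jP] := PP u v.
  by apply: avoid; rewrite inE pP orbT.
rewrite size_cut //; have [ji|ji] := eqVneq j i; last first.
  exists j; first exact: ltnW.
  by rewrite nth_cut // (negbTE ji) ltn_eqF.
have [|H|H] := qP u v; first by apply: avoid; rewrite mem_head.
  exists i; first exact: ltnW.
  by move=> x ux; rewrite nth_cut // eqxx -ji; split; [exact: jP|exact: H].
exists (size s) => //; move=> x ux; rewrite nth_cut // gtn_eqF // eqxx -ji.
by split; [exact: jP|exact: H].
Qed.

Lemma upper_line n M : (0 < n)%N -> fair_split R 1 n 2 M -> (M <= n - 1)%N.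
Proof.
move=> n0 fM; rewrite leqNgt; apply/negP => nM'.
have nM : (n <= M)%N by lia.
(* A radius below 1/2 keeps the intervals around the integers disjoint. *)
have q0 : 0 < 4^-1 :> R by rewrite invr_gt0.
have [mu muP] := @exists_concentrated 1 M (fun j => const_mx j%:R) _ q0.
have [K [cK [szK [l lP]]]] := fM mu (fun j => (muP j).1).
have [P szP PP] := cut_points cK.
(* Pigeonhole: [n] disjoint intervals against [n - 1] cut points. The measure on a free interval
   gives mass 1 to the label of the part containing it. *)
have [j free] : exists j : 'I_n, forall p, p \in P -> ~~ (j%:R - 4^-1 <= p <= j%:R + 4^-1).
  apply: contrapT => H.
  have /choice[f fP] : forall j : 'I_n, exists p, p \in P /\ j%:R - 4^-1 <= p <= j%:R + 4^-1.
    move=> j; apply: contrapT => Hj; apply: H; exists j => p pP; apply/negP => pj.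
    by apply: Hj; exists p.
  have finj : injective f.
    suff lt (j k : 'I_n) : (j < k)%N -> f j != f k.
      move=> j k fjk; apply: val_inj; case: (ltngtP j k) => // /lt.
        by rewrite fjk eqxx.
      by rewrite fjk eqxx.
    move=> jk; apply/eqP => fjk; have := (fP j).2; have := (fP k).2; rewrite fjk.
    have : j%:R + 1 <= k%:R :> R by rewrite natr1 ler_nat.
    lra.
  have : (size (map f (enum 'I_n)) <= size P)%N.
    apply: uniq_leq_size; first by rewrite map_inj_uniq // enum_uniq.
    by move=> p /mapP[j _ ->]; case: (fP j).
  by rewrite size_map size_enum_ord -szK -szP ltnn.
have [i iK iP] := PP _ _ free.
rewrite szK in iK; have jM := leq_trans (ltn_ord j) nM.
apply: (@half_neq1 R); rewrite -(lP (Ordinal jM) (l (Ordinal iK))).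
apply: (full_measure_sup _ _ (muP (Ordinal jM)).2); last first.
- move=> x /cubeP/(_ ord0); rewrite mxE ler_norml => xj.
  by exists (Ordinal iK) => //=; apply: iP; move: xj => /=; lra.
- exact: measurable_box.
apply: fin_bigcup_measurable; first exact: finite_finset.
by move=> i' _; exact: measurable_part.
Qed.

End UpperBounds.

Lemma fair_split_even (R : realType) d t : (0 < d)%N -> (0 < t)%N ->
  fair_split R d (2 * t) 2 (t * (d + 1) - 1).
Proof.
case: d t => // d [//|t] _ _; apply: (@fair_split_lower R d t).
  rewrite addn1; lia.
by left; rewrite mul2n doubleS.
Qed.

Lemma fair_split_odd (R : realType) d t : (0 < d)%N ->
  fair_split R d (2 * t + 1) 2 (t * (d + 1)).
Proof.
case: d => // d _; apply: (@fair_split_lower R d t).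
  by rewrite addn1 mulSn addSn ltnS leq_addl.
by right; rewrite mul2n !addn1.
Qed.

Theorem theorem2 (R : realType) (d : nat) : (1 <= d)%N ->
  (forall t : nat, (1 <= t)%N -> Mpp_ge R d (2 * t) 2 (t * (d + 1) - 1)) /\
  (forall t : nat, Mpp_ge R d (2 * t + 1) 2 (t * (d + 1))) /\
  (forall n : nat, (1 <= n)%N -> Mpp_eq R 1 n 2 (n - 1)) /\
  Mpp_eq R d 3 2 (d + 1) /\
  Mpp_eq R d 2 2 d.
Proof.
move=> d0; split=> [t t0|]; first by eexists; split; [exact: leqnn|exact: fair_split_even].
split=> [t|]; first by eexists; split; [exact: leqnn|exact: fair_split_odd].
split=> [n n0|]; [split|split; split].
- have [on|en] := boolP (odd n).
    have nE : n = (2 * n./2 + 1)%N by rewrite mul2n addn1 -{1}(odd_double_half n) on.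
    have -> : (n - 1 = n./2 * (1 + 1))%N by lia.
    by rewrite {1}nE; exact: fair_split_odd.
  have nE : n = (2 * n./2)%N by rewrite mul2n -{1}(odd_double_half n) (negbTE en).
  have -> : (n - 1 = n./2 * (1 + 1) - 1)%N by lia.
  by rewrite {1}nE; apply: fair_split_even => //; lia.
- by move=> M; exact: upper_line.
- by have := @fair_split_odd R d 1 d0; rewrite mul1n.
- by move=> M; exact: upper3.
- by have := @fair_split_even R d 1 d0 isT; rewrite mul1n addn1 subn1.
- by move=> M; exact: upper2.
Qed.
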